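(* Let $\alpha\in(0,2]$ and $H\in[1/2,1)$ with $\alpha H=3/2$, and let $u$ be the mild solution of $$\partial_tu(t,x)=-(-\Delta)^{\alpha/2}u(t,x)+\dot W(t,x),\quad t\ge0,\ x\in\mathbb{R},\qquad u(0,\cdot)=0,$$ where $\dot W$ is the centered generalized Gaussian noise with covariance $\mathbb{E}[\dot W(t,x)\dot W(s,y)]=|t-s|^{2H-2}\delta(x-y)$. Fix $0<t_1<t_2$. Then for any $\varepsilon\in(0,1)$ there exist $\rho\in(0,1)$ with $\rho=O(\varepsilon^2)$ (that is, $\rho\le C\varepsilon^2$ with a constant $C$ not depending on $\varepsilon$) and $r_\rho\in(0,1)$ such that $$\big|\mathbb{E}[(u(t,x)-u(t,y))(u(t,x')-u(t,y'))]\big|\le\varepsilon\,\|u(t,x)-u(t,y)\|_2\,\|u(t,x')-u(t,y')\|_2$$ for all $t\in[t_1,t_2]$, $r\in(0,r_\rho]$ and $x,y,x',y'\in\mathbb{R}$ with $|x-y|\le r$, $|x'-y'|\le r$ and $|x-x'|\ge2r^\rho$.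
   Context: $\|Y\|_2=(\mathbb{E}|Y|^2)^{1/2}$. $G(t,x)$, $t>0$, $x\in\mathbb{R}$, is the fundamental solution of $\partial_t+(-\Delta)^{\alpha/2}$, i.e. $\int_{\mathbb{R}}e^{-i\xi x}G(t,x)\,dx=e^{-t|\xi|^\alpha}$. The covariance of $\dot W$ means that Wiener integrals with respect to $W$ are centered jointly Gaussian with $\mathbb{E}\big[\iint f\,dW\iint g\,dW\big]=\int_{\mathbb{R}}\int_{\mathbb{R}}|r-r'|^{2H-2}\int_{\mathbb{R}}f(r,z)g(r',z)\,dz\,dr\,dr'$ (the assumptions on $\alpha,H$ force $H\ge3/4$). The mild solution is the centered Gaussian random field $u(t,x)=\int_0^t\int_{\mathbb{R}}G(t-s,x-y)\,W(ds\,dy)$. *)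

(* Defs.v *)
From HB Require Import structures.
From mathcomp Require Import all_boot all_order all_algebra.
From mathcomp Require Import all_classical all_reals all_analysis.

Set Implicit Arguments.
Unset Strict Implicit.
Unset Printing Implicit Defensive.

Import Order.TTheory GRing.Theory Num.Theory.
Import numFieldNormedType.Exports.

Local Open Scope classical_set_scope.
Local Open Scope ring_scope.

(* The complex identity \int e^{-i xi x} G(t,x) dx = e^{-t|xi|^alpha} is split
   into its real and imaginary parts.  It determines each G(t,.) only almost
   everywhere; the joint measurability makes G(t-s,x-y) a legitimate integrand
   in (s,y), and any two such G agree almost everywhere in (t,x). *)
Definition fundamental_solution (R : realType) (alpha : R) (G : R -> R -> R) :=
  [/\ measurable_fun [set p : R * R | 0 < p.1] (fun p : R * R => G p.1 p.2),
      forall t : R, 0 < t ->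
        lebesgue_measure.-integrable [set: R] (EFin \o G t),
      forall t xi : R, 0 < t ->
        (\int[lebesgue_measure]_(x in [set: R]) (cos (xi * x) * G t x)%:E
         = (expR (- t * (`|xi| `^ alpha)))%:E)%E &
      forall t xi : R, 0 < t ->
        (\int[lebesgue_measure]_(x in [set: R]) (sin (xi * x) * G t x)%:E
         = 0)%E].

(* Functions of (time, space) are functions on R * R.  At r = r' the library
   value of 0 `^ (2H - 2) is 0 for H < 1; the diagonal is a null set. *)
Definition noise_cov (R : realType) (H : R) (f g : R * R -> R) : \bar R :=
  (\int[lebesgue_measure]_(r in [set: R])
    \int[lebesgue_measure]_(r' in [set: R])
      ((`|r - r'| `^ (2 * H - 2))%:E *
       \int[lebesgue_measure]_(z in [set: R]) (f (r, z) * g (r', z))%:E))%E.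

(* The integrands for which the covariance integral converges absolutely.
   They form a vector space on which noise_cov is finite, since noise_cov is
   positive semi-definite for 1/2 < H < 1. *)
Definition wiener_integrable (R : realType) (H : R) : set (R * R -> R) :=
  [set f : R * R -> R | measurable_fun [set: R * R] f /\
    (noise_cov H (Num.norm \o f) (Num.norm \o f) < +oo)%E].

(* N(0, s^2), where s = 0 means the Dirac mass at 0; the latter is listed
   separately because the library's normal_prob 0 0 is another law. *)
Definition centered_gaussian d (T : measurableType d) (R : realType)
    (P : probability T R) (X : T -> R) :=
  measurable_fun [set: T] X /\
  ((exists2 s : R, 0 < s &
      forall A : set R, measurable A -> P (X @^-1` A) = normal_prob 0 s A) \/
   (forall A : set R, measurable A -> P (X @^-1` A) = \d_(0 : R) A)).

(* W f stands for \iint f dW; its values outside wiener_integrable H are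
   unconstrained.  Almost sure linearity is a consequence of the covariance
   identity.  Joint Gaussianity means that all finite linear combinations are
   Gaussian. *)
Definition wiener_integral d (T : measurableType d) (R : realType)
    (P : probability T R) (H : R) (W : (R * R -> R) -> {RV P >-> R}) :=
  (forall (n : nat) (f : 'I_n -> R * R -> R) (c : 'I_n -> R),
     (forall i, wiener_integrable H (f i)) ->
     centered_gaussian P (fun w => \sum_(i < n) c i * W (f i) w)) /\
  (forall f g : R * R -> R, wiener_integrable H f -> wiener_integrable H g ->
     'E_P[(W f \* W g)%R] = noise_cov H f g)%E.

Definition mild_integrand (R : realType) (G : R -> R -> R) (t x : R) :
    R * R -> R :=
  fun p => if (0 < p.1) && (p.1 < t) then G (t - p.1) (x - p.2) else 0.

Definition mild_solution d (T : measurableType d) (R : realType)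
    (P : probability T R) (W : (R * R -> R) -> {RV P >-> R})
    (G : R -> R -> R) (u : R -> R -> {RV P >-> R}) :=
  forall t x : R, 0 <= t ->
    {ae P, forall w, u t x w = W (mild_integrand G t x) w}.

(* Main.v *)
Require Import Defs.
From HB Require Import structures.
From mathcomp Require Import all_boot all_order all_algebra.
From mathcomp Require Import all_classical all_reals all_analysis.
From mathcomp Require Import measurable_realfun.
From mathcomp Require Import ring lra.

Set Implicit Arguments.
Unset Strict Implicit.
Unset Printing Implicit Defensive.

Import Order.TTheory GRing.Theory Num.Theory.
Import numFieldNormedType.Exports.

Local Open Scope classical_set_scope.
Local Open Scope ring_scope.

(** Write [al] for the stability index, [ga = 2 * H - 2], and [p s d] for the
symmetric stable density [pi^-1 * \int_0^oo e^(-s xi^al) cos (xi d) dxi].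
Parseval's identity and the semigroup property turn the space integral of
[G(s, x - z) G(s', x' - z)] into [p (s + s') (x - x')], so [u(t, x)] and
[u(t, x')] have covariance [K (x - x')] with
[[
  K d = \int_0^t \int_0^t |r - r'|^ga * p ((t - r) + (t - r')) d dr dr'.
]]
The expectation in the theorem and the two squared norms are therefore the
mixed second differences of [K] at [(x, y, x', y')], [(x, y, x, y)] and
[(x', y', x', y')].

Let [h = x - y], [k = x' - y'], and let [D] be the distance of the midpoints.
The mixed difference of [cos (xi .)] is
[4 sin (xi h / 2) sin (xi k / 2) cos (xi D)].  Estimating the sines by their
arguments bounds the mixed difference of [p s] by a multiple of
[|h k| s^(-3/al)]; one integration by parts in [xi] exchanges a factor
[s^(-1/al)] for [1/D].  Interpolation gives [|h k| s^(-(3 - de)/al) D^(-de)]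
for all [0 <= de <= 1] ([mixed_difference_stable_density_interp]).  On the
diagonal the integrand is nonnegative, and the frequencies near [s^(-1/al)]
alone contribute [h^2 s^(-3/al)] as soon as [|h|^al <= s]
([mixed_difference_stable_density_diag_ge]).

The assumption [al * H = 3/2] says that [ga + 2 = 3/al], which makes the
double time integral of [|r - r'|^ga s^(-3/al)], with [s = 2t - r - r'],
diverge logarithmically.  Two consequences follow.
- The variance of an increment is at least [c h^2 ln (t / |h|^al)], which is
  at least of order [h^2 L] when [|h| <= r] and [L = - ln r]
  ([iterated_integral_ge_ln], [mixed_difference_mild_cov_diag_large]).
- With [de > 0] the time integral converges and is of order [1/de], so the
  covariance of two increments is at most of order [|h k| D^(-de) / de]
  ([time_kernel_integral_le], [normr_mixed_difference_mild_cov_le]).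

Since [D >= r^rho], the choice [de = 1 / (rho L)] gives [D^(-de) <= e] and the
covariance is at most of order [|h k| rho L]
([mixed_difference_mild_cov_small]).  The two powers of [L] cancel: the
correlation is at most a constant times [rho], hence at most [eps] once
[rho = C eps^2] with a small [C], and [r] is so small that [de <= 1] and that
the logarithm in the lower bound dominates [ln t1].

The identity for the space integral needs care because [G] is only known
through its transform: [fourier_inversion] recovers an integrable function
almost everywhere from its integrable transform by smoothing it with the
Poisson kernel, and [fourier_parseval] deduces the inner product. *)

(** * Integrals of real functions *)

Section integral_tools.
Context d (T : measurableType d) (R : realType).
Variable mu : {measure set T -> \bar R}.

Lemma integrable_dominated (D : set T) (f g : T -> R) : measurable D ->
  measurable_fun D f -> (forall x, D x -> `|f x| <= g x) ->
  mu.-integrable D (EFin \o g) -> mu.-integrable D (EFin \o f).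
Proof.
move=> mD mf fg; apply: le_integrable => //; first exact/measurable_EFinP.
by move=> x Dx /=; rewrite lee_fin (le_trans (fg _ Dx))// ler_norm.
Qed.

Lemma normr_Rintegral_le (D : set T) (f g : T -> R) : measurable D ->
  measurable_fun D f -> (forall x, D x -> `|f x| <= g x) ->
  mu.-integrable D (EFin \o g) ->
  `|\int[mu]_(x in D) f x| <= \int[mu]_(x in D) g x.
Proof.
move=> mD mf fg ig.
have intf := integrable_dominated mD mf fg ig.
apply: (le_trans (le_normr_Rintegral mD intf)).
apply: le_Rintegral => //.
exact: (integrable_norm intf).
Qed.

Lemma integrable_mulr_bounded (D : set T) (u c : T -> R) (M : R) :
  measurable D -> mu.-integrable D (EFin \o u) -> measurable_fun D c ->
  (forall x, D x -> `|c x| <= M) ->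
  mu.-integrable D (EFin \o (fun x => u x * c x)).
Proof.
move=> mD iu mc cM.
apply: (@integrable_dominated _ _ (fun x => M * `|u x|)) => //.
- apply: measurable_funM => //; apply/measurable_EFinP; exact: measurable_int iu.
- by move=> x Dx; rewrite normrM mulrC ler_wpM2r// cM.
- by have := integrableZl mD M (integrable_norm iu).
Qed.

Lemma Rintegral_alternating4 (D : set T) (f1 f2 f3 f4 : T -> R) : measurable D ->
  mu.-integrable D (EFin \o f1) -> mu.-integrable D (EFin \o f2) ->
  mu.-integrable D (EFin \o f3) -> mu.-integrable D (EFin \o f4) ->
  \int[mu]_(x in D) (f1 x - f2 x - f3 x + f4 x) =
  \int[mu]_(x in D) f1 x - \int[mu]_(x in D) f2 x -
  \int[mu]_(x in D) f3 x + \int[mu]_(x in D) f4 x.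
Proof.
move=> mD i1 i2 i3 i4.
have i12 : mu.-integrable D (EFin \o (fun x => f1 x - f2 x)).
  exact: integrableB i1 i2.
have i123 : mu.-integrable D (EFin \o (fun x => f1 x - f2 x - f3 x)).
  exact: integrableB i12 i3.
by rewrite (RintegralD mD i123 i4) (RintegralB mD i12 i3) (RintegralB mD i1 i2).
Qed.

End integral_tools.

Section fubini_bounded.
Context d1 d2 (T1 : measurableType d1) (T2 : measurableType d2) (R : realType).
Variable m1 : {sigma_finite_measure set T1 -> \bar R}.
Variable m2 : {sigma_finite_measure set T2 -> \bar R}.

(** The weight [c] is bounded, so [M * |u| * |v|] dominates the integrand on the
product space; integrating over subsets is reduced to the full spaces by
extending [u] and [v] by zero. *)
Lemma Rintegral_fubini_bounded (A : set T1) (B : set T2) (u : T1 -> R)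
    (v : T2 -> R) (c : T1 * T2 -> R) (M : R) :
  measurable A -> measurable B ->
  m1.-integrable A (EFin \o u) -> m2.-integrable B (EFin \o v) ->
  measurable_fun [set: T1 * T2] c -> (forall p, `|c p| <= M) ->
  \int[m1]_(x in A) (u x * \int[m2]_(y in B) (v y * c (x, y))) =
  \int[m2]_(y in B) (v y * \int[m1]_(x in A) (u x * c (x, y))).
Proof.
move=> mA mB iu iv mc cM.
have M0 : 0 <= M by exact: le_trans (cM (point, point)).
pose U := u \_ A; pose V := v \_ B.
have iU : m1.-integrable setT (EFin \o U).
  by move/(integrable_mkcond _ mA) : iu; rewrite restrict_EFin.
have iV : m2.-integrable setT (EFin \o V).
  by move/(integrable_mkcond _ mB) : iv; rewrite restrict_EFin.
have mU : measurable_fun setT U by apply/measurable_EFinP; exact: measurable_int iU.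
have mV : measurable_fun setT V by apply/measurable_EFinP; exact: measurable_int iV.
pose f (p : T1 * T2) := (U p.1 * (V p.2 * c p))%:E.
have mf : measurable_fun setT f.
  apply/measurable_EFinP; apply: measurable_funM.
    exact: (measurableT_comp mU).
  by apply: measurable_funM => //; exact: (measurableT_comp mV).
have secx x : measurable_fun setT (fun y => c (x, y)).
  by apply: measurableT_comp mc _; exact: measurable_pair1.
have secy y : measurable_fun setT (fun x => c (x, y)).
  by apply: measurableT_comp mc _; exact: measurable_pair2.
have bV x : m2.-integrable setT (EFin \o (fun y => V y * c (x, y))).
  exact: (@integrable_mulr_bounded _ _ _ _ _ _ _ M).
have bU y : m1.-integrable setT (EFin \o (fun x => U x * c (x, y))).
  exact: (@integrable_mulr_bounded _ _ _ _ _ _ _ M).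
have intf : (m1 \x m2)%E.-integrable setT f.
  refine ((@integrable12ltyP _ _ _ _ R m1 m2 f mf).2 _).
  have /integrableP[_ hV] := iV.
  have hV' : (\int[m2]_y (`|V y|)%:E \is a fin_num)%E.
    by rewrite ge0_fin_numE//; exact: integral_ge0.
  pose I := fine (\int[m2]_y (`|V y|)%:E)%E.
  have iMU := integrableZl measurableT (M * I) (integrable_norm iU).
  have I0 : 0 <= I by apply: fine_ge0; exact: integral_ge0.
  apply: le_lt_trans (integrable_lty measurableT iMU).
  apply: ge0_le_integral => //.
  - by move=> x _; exact: integral_ge0.
  - apply: (measurable_fun_fubini_tonelli_F (abse \o f)); last by move=> p /=.
    exact: measurableT_comp.
  - exact: measurable_int iMU.
  move=> x _ /=; rewrite -EFinM (_ : M * I * _ = M * `|U x| * I); last by ring.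
  rewrite EFinM fineK// -ge0_integralZl//; last 2 first.
  - by apply/measurable_EFinP; exact: measurableT_comp.
  - by rewrite lee_fin mulr_ge0.
  apply: ge0_le_integral => //.
  - apply/measurable_EFinP; apply: measurableT_comp => //.
    by apply: measurable_funM => //; exact: measurable_funM.
  - apply/measurable_EFinP; apply: measurable_funM => //.
    exact: measurableT_comp.
  move=> y _; rewrite /f/= lee_fin !normrM.
  have := ler_wpM2l (mulr_ge0 (normr_ge0 (U x)) (normr_ge0 (V y))) (cM (x, y)).
  by lra.
have L : \int[m1]_(x in A) (u x * \int[m2]_(y in B) (v y * c (x, y))) =
   fine (\int[m1]_x \int[m2]_y f (x, y)).
  rewrite Rintegral_mkcond; congr fine; apply: eq_integral => x _.
  transitivity ((U x)%:E * \int[m2]_y (V y * c (x,y))%:E)%E; last first.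
    by rewrite -integralZl//; exact: bV.
  rewrite -[X in (_ * X)%E]fineK; last exact: integrable_fin_num (bV x).
  rewrite -EFinM /U !patchE; case: ifPn => // xA; last by rewrite mul0r.
  congr (_ * _)%:E; rewrite Rintegral_mkcond; congr fine.
  by apply: eq_integral => y _; rewrite /V !patchE; case: ifPn => //; rewrite mul0r.
rewrite L (Fubini intf) [RHS]Rintegral_mkcond; congr fine; apply: eq_integral => y _.
transitivity ((V y)%:E * \int[m1]_x (U x * c (x,y))%:E)%E.
  rewrite -integralZl//; last exact: bU.
  by apply: eq_integral => x _; rewrite /f/= -EFinM mulrCA.
rewrite -[X in (_ * X)%E]fineK; last exact: integrable_fin_num (bU y).
rewrite -EFinM /V !patchE; case: ifPn => // yB; last by rewrite mul0r.
congr (_ * _)%:E; rewrite Rintegral_mkcond; congr fine.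
by apply: eq_integral => x _; rewrite /U !patchE; case: ifPn => //; rewrite mul0r.
Qed.

End fubini_bounded.

(** * Improper integrals from primitives *)
Section primitives.
Variable R : realType.
Notation mu := (@lebesgue_measure R).
(* [D] is exhausted by segments on which the fundamental theorem of calculus
   applies; this covers the open and the unbounded intervals at once. *)
Variables (D : set R) (a_ b_ : nat -> R).
Hypothesis ab_ : forall n, a_ n < b_ n.
Hypothesis a_noninc : forall m n, (m <= n)%N -> a_ n <= a_ m.
Hypothesis b_nondec : forall m n, (m <= n)%N -> b_ m <= b_ n.
Hypothesis DE : D = \bigcup_n `[a_ n, b_ n]%classic.
Variables f F : R -> R.
Hypothesis cf : forall x, D x -> {for x, continuous f}.
Hypothesis dF : forall x, D x -> is_derive x 1 F (f x).

Let subD n x : x \in `[a_ n, b_ n] -> D x.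
Proof. by move=> xab; rewrite DE; exists n. Qed.

Let cwf n : {within `[a_ n, b_ n], continuous f}.
Proof. by apply: continuous_in_subspaceT => x /set_mem /subD; exact: cf. Qed.

Let cF x : D x -> {for x, continuous F}.
Proof.
move=> /dF[dFx _]; apply: differentiable_continuous; exact/derivable1_diffP.
Qed.

Let FTC n : (\int[mu]_(x in `[a_ n, b_ n]) (f x)%:E = (F (b_ n) - F (a_ n))%:E)%E.
Proof.
have Da : D (a_ n) by apply: (@subD n); rewrite in_itv/= lexx ltW.
have Db : D (b_ n) by apply: (@subD n); rewrite in_itv/= lexx ltW.
rewrite EFinB; apply: continuous_FTC2 => //.
- split.
  + by move=> x xab; have [] := dF (subD (subset_itv_oo_cc xab)).
  + by apply: cvg_at_right_filter; exact: cF.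
  + by apply: cvg_at_left_filter; exact: cF.
- move=> x xab; rewrite derive1E; have := dF (subD (subset_itv_oo_cc xab)).
  by move=> H; rewrite derive_val.
Qed.

Let ndK : nondecreasing_seq (fun n => `[a_ n, b_ n]%classic).
Proof.
move=> m n mn; apply/subsetPset => x /=; rewrite !in_itv/= => /andP[ax xb].
by rewrite (le_trans (a_noninc mn))// (le_trans xb)// b_nondec.
Qed.

Let mfK n : measurable_fun `[a_ n, b_ n] f.
Proof. by apply: subspace_continuous_measurable_fun => //; exact: cwf. Qed.

(** For a nonnegative integrand the limit along the segments is monotone, so a
bound on the oscillation of the primitive suffices; no limits at the ends of
[D] have to be computed, and integrability comes out as a conclusion. *)
Lemma ge0_integral_primitive_le (L : R) : (forall x, D x -> 0 <= f x) ->
  (forall x y, D x -> D y -> F y - F x <= L) ->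
  (\int[mu]_(x in D) (f x)%:E <= L%:E)%E.
Proof.
move=> f0 FL.
have := @ge0_nondecreasing_set_cvg_integral _ (measurableTypeR R) R (fun n => `[a_ n, b_ n]%classic)
  (EFin \o f) mu ndK (fun=> measurable_itv _) _ _.
rewrite -DE => /(_ _ _)/cvg_lim <- //; last 2 first.
- by move=> n; apply/measurable_EFinP; exact: mfK.
- by move=> n x xab; rewrite lee_fin; apply: f0; exact: (@subD n).
apply: lime_le.
  apply: ereal_nondecreasing_is_cvgn.
  apply: ge0_nondecreasing_set_nondecreasing_integral => //.
  - by move=> n; apply/measurable_EFinP; exact: mfK.
  - by move=> n x xab; rewrite lee_fin; apply: f0; exact: (@subD n).
apply: nearW => n; rewrite [leLHS]FTC lee_fin FL//;
  by apply: (@subD n); rewrite in_itv/= lexx ltW.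
Qed.

Lemma Rintegral_primitive_lim (l0 l1 : R) : mu.-integrable D (EFin \o f) ->
  F (a_ n) @[n --> \oo] --> l0 -> F (b_ n) @[n --> \oo] --> l1 ->
  \int[mu]_(x in D) f x = l1 - l0.
Proof.
move=> intf Fa Fb.
have mD : measurable D by rewrite DE; exact: bigcup_measurable.
have mf : measurable_fun D (EFin \o f) by exact: measurable_int intf.
pose g n := (EFin \o f) \_ `[a_ n, b_ n].
have [] := @dominated_convergence _ _ R mu D mD g (EFin \o f) (abse \o (EFin \o f)) _ mf _ _ _.
- by move=> n; apply/(measurable_restrict _ _ _).1 => //; apply: measurable_funS mf.
- apply: aeW => x; rewrite DE => -[n _ xab].
  apply: cvg_near_cst; near=> m; rewrite /g patchE mem_set//.
  have nm : (n <= m)%N by near: m; exact: nbhs_infty_ge.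
  by have /subsetPset := ndK nm; exact.
- exact: integrable_abse.
- apply: aeW => x n _; rewrite /g patchE; case: ifPn => // _.
  by rewrite abse0 abse_ge0.
move=> _ _ cvgI.
have : (F (b_ n) - F (a_ n))%:E @[n --> \oo] --> (l1 - l0)%:E.
  by apply: cvg_EFin; [exact: nearW|exact: cvgB].
have -> : (fun n => (F (b_ n) - F (a_ n))%:E) =
   (fun n => \int[mu]_(x in D) g n x)%E.
  apply/funext => n; rewrite -FTC /g -integral_mkcondr setIidr//.
  by move=> x; exact: subD.
move=> cvgJ.
rewrite /Rintegral.
by rewrite -(cvg_lim _ cvgI)// (cvg_lim _ cvgJ).
Unshelve. all: by end_near. Qed.

End primitives.

Section exhaustions.
Variable R : realType.
Notation mu := (@lebesgue_measure R).

Lemma itv_oo_exhaustion (a b : R) : a < b ->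
  `]a, b[%classic = \bigcup_n `[a + (b - a) / n.+3%:R, b - (b - a) / n.+3%:R]%classic.
Proof.
move=> ab; have ba0 : 0 < b - a by rewrite subr_gt0.
apply/seteqP; split => [x /=|x [n _] /=]; rewrite !in_itv/=; last first.
  have : 0 < (b - a) / n.+3%:R by rewrite divr_gt0.
  by move: (_ / _) => u u0 /andP[h1 h2]; apply/andP; split; lra.
move=> /andP[ax xb].
pose e := Num.min (x - a) (b - x).
have e0 : 0 < e by rewrite lt_min !subr_gt0 ax.
pose n := Num.truncn ((b - a) / e).
exists n => //=; rewrite in_itv/=.
have h : (b - a) / n.+3%:R <= e.
  rewrite ler_pdivrMr// mulrC -ler_pdivrMr//.
  by apply/ltW/(lt_trans (truncnS_gt _)); rewrite ltr_nat.
by move: h; rewrite le_min; move: (_ / _) => u /andP[h1 h2]; apply/andP; split; lra.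
Qed.

Lemma itv_0y_exhaustion :
  `]0, +oo[%classic = \bigcup_n `[(n.+2%:R^-1 : R), n.+1%:R]%classic.
Proof.
apply/seteqP; split => [x /=|x [n _] /=]; rewrite !in_itv/= ?andbT; last first.
  by move=> /andP[h _]; apply: lt_le_trans h; rewrite invr_gt0.
move=> x0.
pose n := maxn (Num.truncn x^-1) (Num.truncn x).
exists n => //=; rewrite in_itv/=; apply/andP; split.
  rewrite -[leRHS]invrK lef_pV2 ?posrE ?invr_gt0//.
  apply/ltW/(lt_le_trans (truncnS_gt _)); rewrite ler_nat ltnS.
  by rewrite (leq_trans (leq_maxl _ (Num.truncn x))).
apply/ltW/(lt_le_trans (truncnS_gt _)); rewrite ler_nat ltnS.
by rewrite leq_maxr.
Qed.

Lemma ge0_integral_itv_oo_le (a b L : R) (f F : R -> R) : a < b ->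
  (forall x, a < x < b -> {for x, continuous f}) ->
  (forall x, a < x < b -> is_derive x 1 F (f x)) ->
  (forall x, a < x < b -> 0 <= f x) ->
  (forall x y, a < x < b -> a < y < b -> F y - F x <= L) ->
  (\int[mu]_(x in `]a, b[) (f x)%:E <= L%:E)%E.
Proof.
move=> ab cf dF f0 FL; have ba0 : 0 < b - a by rewrite subr_gt0.
have p (x : R) : `]a, b[%classic x -> a < x < b by rewrite /= in_itv/=.
apply: (ge0_integral_primitive_le _ _ _ (itv_oo_exhaustion ab) _
  (fun x Dx => dF x (p x Dx))).
- move=> n.
  have := ltr_nat R 2 n.+3; rewrite ltnS ltnS ltn0Sn => /esym n3.
  have : (b - a) / n.+3%:R < (b - a) / 2 by rewrite ltr_pM2l// ltf_pV2 ?posrE.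
  by move: (_ / n.+3%:R) => u; lra.
- move=> m n mn; rewrite lerD2l ler_pM2l// lef_pV2 ?posrE// ler_nat !ltnS //.
- move=> m n mn; rewrite lerD2l lerN2 ler_pM2l// lef_pV2 ?posrE// ler_nat !ltnS //.
- by move=> x /p; exact: cf.
- by move=> x /p; exact: f0.
- by move=> x y /p x0 /p y0; exact: FL.
Qed.

Let noninc (m n : nat) : (m <= n)%N -> (n.+2%:R^-1 : R) <= m.+2%:R^-1.
Proof. by move=> mn; rewrite lef_pV2 ?posrE// ler_nat !ltnS. Qed.

Let nondec (m n : nat) : (m <= n)%N -> (m.+1%:R : R) <= n.+1%:R.
Proof. by move=> mn; rewrite ler_nat ltnS. Qed.

Let ab (n : nat) : (n.+2%:R^-1 : R) < n.+1%:R.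
Proof. by rewrite invf_plt ?posrE// (@le_lt_trans _ _ 1)// ?invf_le1// ?ler1n// ltr1n. Qed.

Lemma ge0_integral_0y_le (L : R) (f F : R -> R) :
  (forall x : R, 0 < x -> {for x, continuous f}) ->
  (forall x : R, 0 < x -> is_derive x 1 F (f x)) ->
  (forall x : R, 0 < x -> 0 <= f x) ->
  (forall x y : R, 0 < x -> 0 < y -> F y - F x <= L) ->
  (\int[mu]_(x in `]0%R, +oo[) (f x)%:E <= L%:E)%E.
Proof.
move=> cf dF f0 FL.
have p (x : R) : `]0%R, +oo[%classic x -> 0 < x by rewrite /= in_itv/= andbT.
apply: (ge0_integral_primitive_le ab noninc nondec itv_0y_exhaustion
  _ (fun x Dx => dF x (p x Dx))).
- by move=> x /p; exact: cf.
- by move=> x /p; exact: f0.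
- by move=> x y /p x0 /p y0; exact: FL.
Qed.

Lemma Rintegral_0y_primitive (l0 l1 : R) (f F : R -> R) :
  (forall x : R, 0 < x -> {for x, continuous f}) ->
  (forall x : R, 0 < x -> is_derive x 1 F (f x)) ->
  mu.-integrable `]0, +oo[ (EFin \o f) ->
  F x @[x --> 0^'+] --> l0 -> F x @[x --> +oo] --> l1 ->
  \int[mu]_(x in `]0, +oo[) f x = l1 - l0.
Proof.
move=> cf dF intf Fa Fb.
have p (x : R) : `]0%R, +oo[%classic x -> 0 < x by rewrite /= in_itv/= andbT.
apply: (Rintegral_primitive_lim ab noninc nondec itv_0y_exhaustion
  _ (fun x Dx => dF x (p x Dx))) => //.
- by move=> x /p; exact: cf.
- apply: ((cvg_at_rightP F 0 l0).1 Fa); split; first by move=> n; rewrite invr_gt0.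
  have /= := @cvg_harmonic R; rewrite -cvg_shiftS; exact.
- apply: ((cvg_pinftyP F l1).1 Fb); have := @cvgr_idn R.
  by rewrite -cvg_shiftS.
Qed.

End exhaustions.

(** * One-variable calculus *)
Section calculus.
Variable R : realType.
Notation mu := (@lebesgue_measure R).
Implicit Types (f g : R -> R) (x a b c : R).

Lemma is_derive1M f g x a b : is_derive x 1 f a -> is_derive x 1 g b ->
  is_derive x 1 (fun z => f z * g z) (a * g x + f x * b).
Proof.
move=> df dg; have := @is_deriveM _ _ f g x 1 a b df dg.
by rewrite /GRing.scale/= [g x * a]mulrC [f x * b + _]addrC.
Qed.

Lemma is_derive1D f g x a b : is_derive x 1 f a -> is_derive x 1 g b ->
  is_derive x 1 (fun z => f z + g z) (a + b).
Proof. by move=> df dg; exact: is_deriveD. Qed.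

Lemma is_derive1_mull f x a c : is_derive x 1 f a ->
  is_derive x 1 (fun z => c * f z) (c * a).
Proof. by move=> df; exact: is_deriveZ. Qed.

Lemma is_derive1_chain f g x a b : is_derive (g x) 1 f a -> is_derive x 1 g b ->
  is_derive x 1 (fun z => f (g z)) (a * b).
Proof. by move=> df dg; exact: is_derive1_comp. Qed.

Lemma is_derive1_continuous f x a : is_derive x 1 f a -> {for x, continuous f}.
Proof.
move=> [df _]; apply: differentiable_continuous; exact/derivable1_diffP.
Qed.

Lemma is_derive_lin c x : is_derive x 1 (fun z => c * z) c.
Proof. by rewrite -[X in is_derive _ _ _ X]mulr1; apply: is_derive1_mull. Qed.

(** Integrability of the singularity [v^(q - 1)] at either end of an interval. *)
Lemma integral_powR_le a b q : a < b -> 0 < q ->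
  (\int[mu]_(r in `]a, b[) ((r - a) `^ (q - 1))%:E <= ((b - a) `^ q / q)%:E)%E /\
  (\int[mu]_(r in `]a, b[) ((b - r) `^ (q - 1))%:E <= ((b - a) `^ q / q)%:E)%E.
Proof.
move=> ab q0.
have dp p x : 0 < x -> is_derive x 1 (fun y => y `^ p) (p * x `^ (p - 1)).
  by move=> x0; exact: is_derive1_powR.
have d1 (x : R) : is_derive x 1 (fun r : R => r - a) 1.
  by rewrite -[X in is_derive _ _ _ X]addr0; exact: is_derive1D.
have d2 (x : R) : is_derive x 1 (fun r : R => b - r) (-1).
  rewrite -[X in is_derive _ _ _ X]add0r; exact: is_derive1D.
have le_ (x : R) : 0 <= x < b - a -> x `^ q <= (b - a) `^ q.
  by move=> /andP[x0 xb]; apply: ge0_ler_powR; rewrite ?nnegrE//; lra.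
split.
- apply: (@ge0_integral_itv_oo_le _ _ _ _ _ (fun r => q^-1 * (r - a) `^ q)) => //.
  + move=> x /andP[ax xb].
    apply: is_derive1_continuous.
    apply: (@is_derive1_chain (fun y => y `^ (q - 1))) (d1 x).
    by apply: dp; rewrite subr_gt0.
  + move=> x /andP[ax xb].
    have -> : (x - a) `^ (q - 1) = q^-1 * (q * (x - a) `^ (q - 1) * 1).
      by field; rewrite gt_eqF.
    apply: is_derive1_mull; apply: (@is_derive1_chain (fun y => y `^ q)) (d1 x).
    by apply: dp; rewrite subr_gt0.
  + by move=> x _; exact: powR_ge0.
  + move=> x y /andP[ax xb] /andP[ay yb].
    rewrite -mulrBr mulrC ler_pM2r ?invr_gt0//.
    have := powR_ge0 (x - a) q; have := @le_ (y - a); lra.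
- apply: (@ge0_integral_itv_oo_le _ _ _ _ _ (fun r => - q^-1 * (b - r) `^ q)) => //.
  + move=> x /andP[ax xb].
    apply: is_derive1_continuous.
    apply: (@is_derive1_chain (fun y => y `^ (q - 1))) (d2 x).
    by apply: dp; rewrite subr_gt0.
  + move=> x /andP[ax xb].
    have -> : (b - x) `^ (q - 1) = - q^-1 * (q * (b - x) `^ (q - 1) * -1).
      by field; rewrite gt_eqF.
    apply: is_derive1_mull; apply: (@is_derive1_chain (fun y => y `^ q)) (d2 x).
    by apply: dp; rewrite subr_gt0.
  + by move=> x _; exact: powR_ge0.
  + move=> x y /andP[ax xb] /andP[ay yb].
    rewrite -mulrBr mulrC mulrN -mulNr ler_pM2r ?invr_gt0//.
    have := powR_ge0 (b - y) q; have := @le_ (b - x); lra.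
Qed.

Lemma is_derive_expRl c x : is_derive x 1 (fun z => expR (- c * z)) (- c * expR (- c * x)).
Proof. by rewrite mulrC; apply: is_derive1_chain (is_derive_lin _ _). Qed.

Lemma expRNM_cvg0 c : 0 < c -> expR (- c * x) @[x --> +oo] --> 0.
Proof.
move=> c0.
rewrite (_ : (fun x => expR (- c * x)) = (fun z => expR (- z)) \o (fun z => c * z)); last first.
  by apply: eq_fun => x; rewrite mulNr.
by apply: cvg_comp; [exact: gt0_cvgMry|exact: cvgr_expR].
Qed.

Lemma measurable_expRl c (D : set R) : measurable_fun D (fun x => expR (- c * x)).
Proof.
apply: measurable_funTS; apply: continuous_measurable_fun => x.
exact: is_derive1_continuous (is_derive_expRl _ _).
Qed.

Lemma integrable_expR c : 0 < c ->
  mu.-integrable `]0, +oo[ (EFin \o (fun x => expR (- c * x))).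
Proof.
move=> c0; apply/integrableP; split; first by apply/measurable_EFinP; exact: measurable_expRl.
under eq_integral do rewrite /= ger0_norm ?expR_ge0//.
apply: (@le_lt_trans _ _ (c^-1)%:E); last by rewrite ltry.
apply: (@ge0_integral_0y_le _ _ _ (fun x => - c^-1 * expR (- c * x))) => //.
- by move=> x _; exact: is_derive1_continuous (is_derive_expRl _ _).
- move=> x _; have := is_derive1_mull (- c^-1) (is_derive_expRl c x).
  by rewrite mulrA mulrNN mulVf ?mul1r// gt_eqF.
- move=> x y x0 y0; rewrite -mulrBr mulrC mulrN -mulNr ler_piMl ?invr_ge0 ?ltW//.
  have : expR (- c * x) <= 1 by rewrite expR_le1 nmulr_rle0// ?oppr_lt0// ltW.
  by have := expR_gt0 (- c * y); lra.
Qed.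

Lemma Rintegral_expR c : 0 < c ->
  \int[mu]_(x in `]0, +oo[) expR (- c * x) = c^-1.
Proof.
move=> c0.
rewrite -[RHS]opprK -[RHS]sub0r.
apply: (@Rintegral_0y_primitive _ (- c^-1) 0 _ (fun x => - c^-1 * expR (- c * x))).
- by move=> x _; exact: is_derive1_continuous (is_derive_expRl _ _).
- move=> x _; have := is_derive1_mull (- c^-1) (is_derive_expRl c x).
  by rewrite mulrA mulrNN mulVf ?mul1r// gt_eqF.
- exact: integrable_expR.
- have e : - c^-1 = - c^-1 * expR (- c * 0) by rewrite mulr0 expR0 mulr1.
  rewrite [X in _ --> X]e; apply: cvg_at_right_filter.
  exact: is_derive1_continuous (is_derive1_mull (- c^-1) (is_derive_expRl c 0)).
- by rewrite -[X in _ --> X](mulr0 (- c^-1)); apply: cvgMr; exact: expRNM_cvg0.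
Qed.

End calculus.

(** * Elementary trigonometric inequalities *)
Section trigonometric_bounds.
Variable R : realType.
Implicit Types x v : R.

Lemma ge0_of_derive_ge0 (f df : R -> R) : f 0 = 0 ->
  (forall x, is_derive x 1 f (df x)) -> (forall x, 0 <= x -> 0 <= df x) ->
  forall x, 0 <= x -> 0 <= f x.
Proof.
move=> f0 dfE df0 x; rewrite le_eqVlt => /predU1P[<-|x0]; first by rewrite f0.
have [] := @MVT_segment R f df 0 x (ltW x0).
  apply: continuous_subspaceT => y; exact: is_derive1_continuous (dfE y).
move=> c; rewrite in_itv/= => /andP[c0 _]; rewrite f0 !subr0 => ->.
by rewrite mulr_ge0 ?df0// ltW.
Qed.

Lemma sin_le_id x : 0 <= x -> sin x <= x.
Proof.
move=> x0; rewrite -subr_ge0.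
apply: (@ge0_of_derive_ge0 (fun x => x - sin x) (fun x => 1 - cos x)) => //.
by rewrite sin0 subr0.
Qed.

Lemma cos_ge_taylor2 x : 0 <= x -> 1 - x ^+ 2 / 2 <= cos x.
Proof.
move=> x0; rewrite -subr_ge0.
apply: (@ge0_of_derive_ge0 (fun x => cos x - (1 - x ^+ 2 / 2)) (fun x => x - sin x)) => //.
- by rewrite cos0 expr0n/= mul0r subr0 subrr.
- by move=> y; apply: is_derive_eq; rewrite /GRing.scale/=; field.
- by move=> y y0; rewrite subr_ge0 sin_le_id.
Qed.

Lemma sin_ge_taylor3 x : 0 <= x -> x - x ^+ 3 / 6 <= sin x.
Proof.
move=> x0; rewrite -subr_ge0.
apply: (@ge0_of_derive_ge0 (fun x => sin x - (x - x ^+ 3 / 6))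
  (fun x => cos x - (1 - x ^+ 2 / 2))) => //.
- by rewrite sin0 expr0n/= mul0r !subr0.
- by move=> y; apply: is_derive_eq; rewrite /GRing.scale/=; field.
- by move=> y y0; rewrite subr_ge0 cos_ge_taylor2.
Qed.

Lemma normr_sin_le x : `|sin x| <= `|x|.
Proof.
have h (y : R) : 0 <= y -> `|sin y| <= y.
  move=> y0; rewrite ler_norml; apply/andP; split; last exact: sin_le_id.
  have [y1|y1] := leP 1 y; first by have := sin_geN1 y; lra.
  have := sin_ge_taylor3 y0.
  have : y ^+ 3 <= y by rewrite exprS ler_piMr// expr_le1// ltW.
  by lra.
have [x0|x0] := leP 0 x; first by rewrite (ger0_norm x0) h.
by rewrite (ltr0_norm x0) -normrN -sinN h// oppr_ge0 ltW.
Qed.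

(** From [sin v >= v - v^3 / 6] one gets [sin v >= (4/5) v] for [v] between 0 and 1/2,
and [(4/5)^2 >= 1/2]. *)
Lemma sqr_sin_ge v : `|v| <= 2^-1 -> v ^+ 2 / 2 <= sin v ^+ 2.
Proof.
wlog v0 : v / 0 <= v => [h|].
  have [/h//|/ltW v0] := leP 0 v.
  by rewrite -normrN => /h; rewrite oppr_ge0 sinN !sqrrN; exact.
rewrite ger0_norm//; move: v v0 => w w0 w1.
have h := sin_ge_taylor3 w0.
have h1 : w * (4 / 5) <= sin w.
  apply: le_trans h.
  have : w ^+ 2 <= 2^-1 ^+ 2 by rewrite ler_sqr ?nnegrE ?invr_ge0.
  by rewrite exprSr; nra.
have w2 : 0 <= w * (4 / 5) by rewrite mulr_ge0 ?divr_ge0.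
have : (w * (4 / 5)) ^+ 2 <= sin w ^+ 2 by rewrite ler_sqr ?nnegrE// (le_trans w2).
by have := sqr_ge0 w; move: (sin w) => sw; lra.
Qed.

Lemma measurable_cos : measurable_fun [set: R] (@cos R).
Proof. by apply: continuous_measurable_fun; exact: continuous_cos. Qed.

Lemma measurable_sin : measurable_fun [set: R] (@sin R).
Proof. by apply: continuous_measurable_fun; exact: continuous_sin. Qed.

End trigonometric_bounds.

(** * Exponentially weighted integrals on the half-line *)
Section exponential_domination.
Variable R : realType.
Notation mu := (@lebesgue_measure R).

Lemma Rintegral_exp_dominated (f : R -> R) (K c : R) : 0 < c ->
  measurable_fun (`]0, +oo[%classic : set R) f ->
  (forall x : R, 0 < x -> `|f x| <= K * expR (- c * x)) ->
  mu.-integrable `]0, +oo[ (EFin \o f) /\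
  `|\int[mu]_(x in `]0, +oo[) f x| <= K / c.
Proof.
move=> c0 mf fK.
have h (x : R) : `]0, +oo[%classic x -> `|f x| <= K * expR (- c * x).
  by rewrite /= in_itv/= andbT; exact: fK.
have iK : mu.-integrable `]0, +oo[ (EFin \o (fun x => K * expR (- c * x))).
  have := @integrableZl _ _ _ mu `]0, +oo[ (measurable_itv _) K _ (integrable_expR c0).
  by [].
split.
  exact: (@integrable_dominated _ _ _ mu _ _ _ (measurable_itv _) mf h).
apply: le_trans.
  exact: (@normr_Rintegral_le _ _ _ mu _ _ _ (measurable_itv _) mf h).
by rewrite RintegralZl//; [rewrite Rintegral_expR|exact: integrable_expR].
Qed.

(** The transform of the exponential is the Poisson kernel; the primitive used
below comes from integrating by parts twice. *)
Lemma Rintegral_expR_cos (eta x : R) : 0 < eta ->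
  \int[mu]_(xi in `]0, +oo[) (expR (- eta * xi) * cos (xi * x)) =
  eta / (eta ^+ 2 + x ^+ 2).
Proof.
move=> eta0.
have q0 : eta ^+ 2 + x ^+ 2 != 0 by rewrite gt_eqF// ltr_pwDl ?sqr_ge0// exprn_gt0.
pose f (xi : R) := expR (- eta * xi) * cos (xi * x).
pose F (xi : R) := (eta ^+ 2 + x ^+ 2)^-1 *
  (expR (- eta * xi) * (x * sin (xi * x) - eta * cos (xi * x))).
have dF (xi : R) : is_derive xi 1 F (f xi).
  have -> : f xi = (eta ^+ 2 + x ^+ 2)^-1 *
    (- eta * expR (- eta * xi) * (x * sin (xi * x) - eta * cos (xi * x)) +
     expR (- eta * xi) * (x * (cos (xi * x) * x) - eta * (- sin (xi * x) * x))).
    by rewrite /f; field.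
  have dx : is_derive xi 1 (fun z => z * x) x.
    by under eq_fun do rewrite mulrC; exact: is_derive_lin.
  apply: is_derive1_mull; apply: is_derive1M; exact: is_derive_expRl.
have cf (xi : R) : {for xi, continuous f}.
  have dx : is_derive xi 1 (fun z => z * x) x.
    by under eq_fun do rewrite mulrC; exact: is_derive_lin.
  exact: is_derive1_continuous (is_derive1M (is_derive_expRl eta xi) (is_derive1_chain _ dx)).
have fle (xi : R) : 0 < xi -> `|f xi| <= 1 * expR (- eta * xi).
  move=> _; rewrite normrM ger0_norm ?expR_ge0// mul1r.
  by rewrite -[leRHS]mulr1 ler_wpM2l ?expR_ge0// cos_max.
have mf : measurable_fun (`]0, +oo[%classic : set R) f.
  by apply: measurable_funTS; exact: continuous_measurable_fun.
rewrite (_ : eta / _ = 0 - - (eta / (eta ^+ 2 + x ^+ 2))); last by rewrite sub0r opprK.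
apply: (@Rintegral_0y_primitive _ _ _ _ F).
- by move=> xi _; exact: cf.
- exact: (Rintegral_exp_dominated eta0 mf fle).1.
- have -> : - (eta / (eta ^+ 2 + x ^+ 2)) = F 0.
    by rewrite /F mulr0 mul0r expR0 sin0 cos0 !mulr0 mul1r sub0r mulr1 mulrN mulrC.
  by apply: cvg_at_right_filter; exact: is_derive1_continuous (dF 0).
- pose K := `|(eta ^+ 2 + x ^+ 2)^-1| * (`|x| + `|eta|).
  have Fle (xi : R) : `|F xi| <= K * expR (- eta * xi).
    rewrite /F /K !normrM -mulrA ler_wpM2l// (ger0_norm (expR_ge0 _)) mulrC.
    rewrite ler_wpM2r ?expR_ge0// (le_trans (ler_normB _ _))// lerD// normrM.
      by rewrite ler_piMr// sin_max.
    by rewrite ler_piMr// cos_max.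
  apply/norm_cvg0P; apply: (@squeeze_cvgr _ _ _ _ (fun=> 0) (fun xi => K * expR (- eta * xi))).
  + by apply: nearW => xi; rewrite normr_ge0 Fle.
  + exact: cvg_cst.
  + by rewrite -[X in _ --> X](mulr0 K); apply: cvgMr; exact: expRNM_cvg0.
Qed.

End exponential_domination.

(** * Mixed differences of stable densities *)
Section stable_kernel.
Variables (R : realType) (al : R).
Hypotheses (al1 : 1 < al) (al2 : al <= 2).
Notation mu := (@lebesgue_measure R).
Notation pos := (`]0%R, +oo[%classic : set R).
Implicit Types (t xi x y h k p b : R).

(** [stable_cf t] is the characteristic function at positive frequencies, and
[stable_density t] its inverse transform, folded onto the half-line by
symmetry. *)
Definition stable_cf t xi := expR (- t * xi `^ al).
Definition stable_density t x :=
  pi^-1 * \int[mu]_(xi in `]0, +oo[) (stable_cf t xi * cos (xi * x)).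

(* The frequency scale at time [t] is [1 / rate t]. *)
Local Notation rate t := (t `^ al^-1).

Let al_gt0 : 0 < al. Proof. exact: lt_trans al1. Qed.

Lemma rate_gt0 t : 0 < t -> 0 < rate t.
Proof. exact: powR_gt0. Qed.

Lemma powR_rate t : 0 < t -> rate t `^ al = t.
Proof. by move=> t0; rewrite -powRrM mulVf ?gt_eqF// powRr1// ltW. Qed.

(** Since [v^al >= v - 1] for [v >= 0] and [al >= 1], the stable characteristic
function is dominated by an exponential with rate [t^(1/al)]; every integral
below is estimated through this comparison. *)
Lemma rate_subr1_le t xi : 0 < t -> 0 < xi -> rate t * xi - 1 <= t * xi `^ al.
Proof.
move=> t0 xi0; have b0 := rate_gt0 t0.
rewrite -{2}(powR_rate t0) -powRM ?ltW//; set v := _ * xi.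
have v0 : 0 < v by rewrite mulr_gt0.
have [v1|v1] := leP 1 v; last by have := powR_ge0 v al; lra.
by have := le1r_powR v1 (ltW al1); lra.
Qed.

Lemma stable_cf_gt0 t xi : 0 < stable_cf t xi.
Proof. exact: expR_gt0. Qed.

Lemma stable_cf_le t xi : 0 < t -> 0 < xi ->
  stable_cf t xi <= expR 1 * expR (- rate t * xi).
Proof.
by move=> t0 xi0; rewrite -expRD ler_expR; have := rate_subr1_le t0 xi0; lra.
Qed.

Lemma measurable_stable_cf t (D : set R) : measurable_fun D (stable_cf t).
Proof.
apply: measurable_funTS; apply: measurableT_comp => //.
by apply: measurable_funM => //; exact: measurable_powR.
Qed.

Lemma measurable_cosM x (D : set R) : measurable_fun D (fun xi => cos (xi * x)).
Proof.
apply: measurable_funTS; apply: (measurableT_comp (@measurable_cos R)).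
exact: measurable_funM.
Qed.

Lemma measurable_sinM x (D : set R) : measurable_fun D (fun xi => sin (xi * x)).
Proof.
apply: measurable_funTS; apply: (measurableT_comp (@measurable_sin R)).
exact: measurable_funM.
Qed.

Lemma Rintegral_stable_cf_bounded t (g : R -> R) (M : R) : 0 < t ->
  measurable_fun pos g -> (forall xi, 0 < xi -> `|g xi| <= M) ->
  mu.-integrable `]0, +oo[ (EFin \o (fun xi => stable_cf t xi * g xi)) /\
  `|\int[mu]_(xi in `]0, +oo[) (stable_cf t xi * g xi)| <= expR 1 * M / rate t.
Proof.
move=> t0 mg gM; apply: Rintegral_exp_dominated; first exact: rate_gt0.
  by apply: measurable_funM => //; exact: measurable_stable_cf.
move=> xi xi0; rewrite normrM (gtr0_norm (stable_cf_gt0 _ _)).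
rewrite mulrAC ler_pM//; [exact: ltW (stable_cf_gt0 _ _)|exact: stable_cf_le|exact: gM].
Qed.

Lemma integrable_stable_cf t : 0 < t ->
  mu.-integrable `]0, +oo[ (EFin \o stable_cf t).
Proof.
move=> t0.
have [] := @Rintegral_stable_cf_bounded t (fun=> 1) 1 t0.
- exact: measurable_cst.
- by move=> xi _; rewrite normr1.
by move=> + _; under [fun xi => _ * 1]eq_fun do rewrite mulr1.
Qed.

Lemma integrable_stable_cf_cos t x : 0 < t ->
  mu.-integrable `]0, +oo[ (EFin \o (fun xi => stable_cf t xi * cos (xi * x))).
Proof.
move=> t0.
have [] := @Rintegral_stable_cf_bounded t (fun xi => cos (xi * x)) 1 t0 => //.
- exact: measurable_cosM.
- by move=> xi _; exact: cos_max.
Qed.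

Lemma normr_stable_density_le t x : 0 < t ->
  `|stable_density t x| <= pi^-1 * expR 1 / rate t.
Proof.
move=> t0; rewrite /stable_density normrM -mulrA ger0_norm ?invr_ge0 ?pi_ge0//.
rewrite ler_wpM2l ?invr_ge0 ?pi_ge0//.
have [_] := @Rintegral_stable_cf_bounded t (fun xi => cos (xi * x)) 1 t0
  (@measurable_cosM x _) (fun xi _ => cos_max _).
by rewrite mulr1.
Qed.

(** If [f (x - x')] is the covariance of [X x] and [X x'], this is the covariance
of the increments [X x - X y] and [X x' - X y']. *)
Definition mixed_difference (f : R -> R) x y x' y' :=
  f (x - x') - f (x - y') - f (y - x') + f (y - y').

(** The increments only enter through the two sines, and the position of the
midpoints only through the last cosine: this separates the smallness in
[x - y] and [x' - y'] from the decay in the distance. *)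
Lemma mixed_difference_cos xi x y x' y' :
  mixed_difference (fun z => cos (xi * z)) x y x' y' =
  4 * sin (xi * ((x - y) / 2)) * sin (xi * ((x' - y') / 2)) *
  cos (xi * ((x + y) / 2 - (x' + y') / 2)).
Proof.
rewrite /mixed_difference.
set a := xi * ((x + y) / 2 - _); set u := xi * ((x - y) / 2).
set v := xi * ((x' - y') / 2).
have -> : xi * (x - x') = a + u - v by rewrite /a /u /v; field.
have -> : xi * (x - y') = a + u + v by rewrite /a /u /v; field.
have -> : xi * (y - x') = a - u - v by rewrite /a /u /v; field.
have -> : xi * (y - y') = a - u + v by rewrite /a /u /v; field.
by rewrite !(cosB, sinB, cosD, sinD); ring.
Qed.

Lemma mixed_difference_stable_density t x y x' y' : 0 < t ->
  mixed_difference (stable_density t) x y x' y' =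
  pi^-1 * \int[mu]_(xi in `]0, +oo[)
    (stable_cf t xi * (4 * sin (xi * ((x - y) / 2)) * sin (xi * ((x' - y') / 2)) *
      cos (xi * ((x + y) / 2 - (x' + y') / 2)))).
Proof.
move=> t0; rewrite /mixed_difference /stable_density -!mulrBr -mulrDr.
congr (_ * _).
have ic z := integrable_stable_cf_cos z t0.
have mp : measurable pos by exact: measurable_itv.
rewrite -(@Rintegral_alternating4 _ _ _ mu pos _ _ _ _ mp (ic _) (ic _) (ic _) (ic _)).
apply: eq_Rintegral => xi _.
by rewrite -mixed_difference_cos /mixed_difference; ring.
Qed.

Lemma normr_sinM_half xi h : 0 < xi -> `|sin (xi * (h / 2))| <= xi * `|h| / 2.
Proof.
move=> xi0; apply: le_trans (normr_sin_le _) _.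
by rewrite !normrM (gtr0_norm xi0) normfV (@gtr0_norm _ 2)// mulrA.
Qed.

Lemma quadratic_le_expR (c : R) : 0 <= c -> c ^+ 2 <= 8 * expR (c / 2).
Proof.
move=> c0; have c20 : 0 <= c / 2 by rewrite divr_ge0.
have := expR_ge1Dxn 1 c20; rewrite (_ : 2`!%:R = 2 :> R)//.
by rewrite expr_div_n; lra.
Qed.

(** Half of the exponential decay absorbs the factor [xi^2]. *)
Lemma stable_cf_sqr_le t xi : 0 < t -> 0 < xi ->
  xi ^+ 2 * stable_cf t xi <=
  8 * expR 1 / rate t ^+ 2 * expR (- (rate t / 2) * xi).
Proof.
move=> t0 xi0; have b0 := rate_gt0 t0; set b := rate t in b0 *.
apply: (@le_trans _ _ (xi ^+ 2 * (expR 1 * expR (- b * xi)))).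
  by rewrite ler_wpM2l ?sqr_ge0// stable_cf_le.
have e : expR (- b * xi) = expR (- (b / 2) * xi) * expR (- (b / 2) * xi).
  by rewrite -expRD; congr expR; field.
have h : (b * xi) ^+ 2 * expR (- (b / 2) * xi) <= 8.
  have := quadratic_le_expR (ltW (mulr_gt0 b0 xi0)).
  have -> : - (b / 2) * xi = - (b * xi / 2) by field.
  by rewrite expRN ler_pdivrMr ?expR_gt0.
rewrite e.
have -> : xi ^+ 2 * (expR 1 * (expR (- (b / 2) * xi) * expR (- (b / 2) * xi))) =
  ((b * xi) ^+ 2 * expR (- (b / 2) * xi)) *
  (expR 1 / b ^+ 2 * expR (- (b / 2) * xi)) by field; rewrite gt_eqF.
have -> : 8 * expR 1 / b ^+ 2 * expR (- (b / 2) * xi) =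
  8 * (expR 1 / b ^+ 2 * expR (- (b / 2) * xi)) by field; rewrite gt_eqF.
by rewrite ler_wpM2r// mulr_ge0 ?divr_ge0 ?sqr_ge0 ?expR_ge0.
Qed.

Let prod_sin h k xi := 4 * sin (xi * (h / 2)) * sin (xi * (k / 2)).

Let prod_sin_le h k xi : 0 < xi -> `|prod_sin h k xi| <= `|h| * `|k| * xi ^+ 2.
Proof.
move=> xi0; rewrite /prod_sin !normrM (@gtr0_norm _ 4)//.
have := ler_pM (normr_ge0 _) (normr_ge0 _) (normr_sinM_half h xi0) (normr_sinM_half k xi0).
by nra.
Qed.

Let measurable_prod_sin h k P (D : set R) :
  measurable_fun D (fun xi => prod_sin h k xi * cos (xi * P)).
Proof.
apply: measurable_funM; last exact: measurable_cosM.
apply: measurable_funM; last exact: measurable_sinM.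
by apply: measurable_funM => //; exact: measurable_sinM.
Qed.

(** Each sine is at most its argument, which leaves the second moment of
[stable_cf t], of order [rate t ^ (-3)]. *)
Lemma mixed_difference_stable_density_le t x y x' y' : 0 < t ->
  `|mixed_difference (stable_density t) x y x' y'| <=
  16 * expR 1 / pi * (`|x - y| * `|x' - y'|) / rate t ^+ 3.
Proof.
move=> t0; rewrite mixed_difference_stable_density//.
have b0 := rate_gt0 t0; set b := rate t in b0 *.
set h := x - y; set k := x' - y'; set P := (_ - _).
rewrite normrM gtr0_norm ?invr_gt0 ?pi_gt0//.
have [] := @Rintegral_exp_dominated R
  (fun xi => stable_cf t xi * (prod_sin h k xi * cos (xi * P)))
  (`|h| * `|k| * (8 * expR 1 / b ^+ 2)) (b / 2) (divr_gt0 b0 (ltr0Sn _ _)).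
- apply: measurable_funM; first exact: measurable_stable_cf.
  exact: measurable_prod_sin.
- move=> xi xi0; rewrite normrM (gtr0_norm (stable_cf_gt0 _ _)) normrM.
  apply: (@le_trans _ _ (stable_cf t xi * (`|h| * `|k| * xi ^+ 2))).
    rewrite ler_wpM2l ?(ltW (stable_cf_gt0 _ _))//.
    apply: le_trans (prod_sin_le h k xi0).
    by rewrite ler_piMr ?cos_max.
  rewrite mulrC -!mulrA ler_wpM2l// ler_wpM2l// !mulrA.
  exact: stable_cf_sqr_le.
move=> _ H.
rewrite mulrC -ler_pdivlMr ?invr_gt0 ?pi_gt0//; apply: le_trans H _.
move: (pi_gt0 R); move: (pi : R) => q q0.
rewrite le_eqVlt; apply/orP; left; apply/eqP; field.
by rewrite !gt_eqF.
Qed.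

Lemma is_derive_stable_cf t xi : 0 < xi ->
  is_derive xi 1 (stable_cf t) (stable_cf t xi * (- t * (al * xi `^ (al - 1)))).
Proof.
move=> xi0; apply: (@is_derive1_chain _ expR (fun z => - t * z `^ al)).
by apply: is_derive1_mull; exact: is_derive1_powR.
Qed.

Let d_prod_sin h k xi :=
  4 * (h / 2 * cos (xi * (h / 2)) * sin (xi * (k / 2)) +
       k / 2 * sin (xi * (h / 2)) * cos (xi * (k / 2))).

Let is_derive_prod_sin h k xi :
  is_derive xi 1 (prod_sin h k) (d_prod_sin h k xi).
Proof.
have dx c : is_derive xi 1 (fun z => z * c) c.
  by under eq_fun do rewrite mulrC; exact: is_derive_lin.
have -> : d_prod_sin h k xi =
  4 * (cos (xi * (h / 2)) * (h / 2)) * sin (xi * (k / 2)) +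
  4 * sin (xi * (h / 2)) * (cos (xi * (k / 2)) * (k / 2)).
  by rewrite /d_prod_sin; ring.
exact: is_derive1M.
Qed.

Let d_prod_sin_le h k xi : 0 < xi ->
  `|d_prod_sin h k xi| <= 2 * (`|h| * `|k|) * xi.
Proof.
move=> xi0; rewrite /d_prod_sin normrM (@gtr0_norm _ 4)//.
have sh := normr_sinM_half h xi0; have sk := normr_sinM_half k xi0.
have := ler_normD (h / 2 * cos (xi * (h / 2)) * sin (xi * (k / 2)))
  (k / 2 * sin (xi * (h / 2)) * cos (xi * (k / 2))).
have : `|h / 2 * cos (xi * (h / 2)) * sin (xi * (k / 2))| <= `|h| / 2 * (xi * `|k| / 2).
  rewrite normrM ler_pM// normrM normrM normfV (@gtr0_norm _ 2)// ler_piMr ?cos_max//.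
have : `|k / 2 * sin (xi * (h / 2)) * cos (xi * (k / 2))| <= `|k| / 2 * (xi * `|h| / 2).
  rewrite normrM -[leRHS]mulr1 ler_pM ?cos_max// normrM ler_pM// normrM normfV.
  by rewrite (@gtr0_norm _ 2).
by nra.
Qed.

(* The derivative of the amplitude [stable_cf t * prod_sin h k], which is what
   remains after integrating the oscillating factor by parts. *)
Let d_amplitude t h k xi :=
  stable_cf t xi * (- t * (al * xi `^ (al - 1))) * prod_sin h k xi +
  stable_cf t xi * d_prod_sin h k xi.

Let d_amplitude_le t h k xi : 0 < t -> 0 < xi ->
  `|d_amplitude t h k xi| <=
  16 * expR 1 * (`|h| * `|k|) / rate t * expR (- (rate t / 4) * xi).
Proof.
move=> t0 xi0; have b0 := rate_gt0 t0.
have := rate_subr1_le t0 xi0; set b := rate t in b0 *.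
set w := t * xi `^ al => bw.
have w0 : 0 <= w by rewrite mulr_ge0 ?powR_ge0// ltW.
have cfE : stable_cf t xi = expR (- w) by rewrite /stable_cf mulNr.
have hk0 : 0 <= `|h| * `|k| by rewrite mulr_ge0.
apply: (@le_trans _ _ (expR (- w) * (2 + 2 * w) * (`|h| * `|k| * xi))).
  rewrite /d_amplitude cfE -mulrA -mulrDr normrM gtr0_norm ?expR_gt0//.
  rewrite -[leRHS]mulrA ler_wpM2l ?expR_ge0//.
  apply: le_trans (ler_normD _ _) _.
  have h1 : `|- t * (al * xi `^ (al - 1)) * prod_sin h k xi| <=
      (2 * w) * (`|h| * `|k| * xi).
    rewrite normrM mulNr normrN (@ger0_norm _ (t * _)); last first.
      by rewrite mulr_ge0 ?ltW// mulr_gt0// powR_gt0.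
    have e : xi `^ al = xi * xi `^ (al - 1) by rewrite mulr_powRB1// ltW.
    apply: (@le_trans _ _ (t * (al * xi `^ (al - 1)) * (`|h| * `|k| * xi ^+ 2))).
      rewrite ler_wpM2l//; last exact: prod_sin_le.
      by rewrite mulr_ge0 ?ltW// mulr_gt0// powR_gt0.
    have -> : t * (al * xi `^ (al - 1)) * (`|h| * `|k| * xi ^+ 2) =
      al * w * (`|h| * `|k| * xi) by rewrite /w e; ring.
    by rewrite ler_wpM2r ?mulr_ge0 ?(ltW xi0)// ler_wpM2r.
  have := d_prod_sin_le h k xi0; lra.
(* Half of [expR (- w)] absorbs the factor [1 + w] produced by
   differentiating [stable_cf t]. *)
have h2 : expR (- w) * (2 + 2 * w) <= 4 * (expR 1 * expR (- (b / 2) * xi)).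
  apply: (@le_trans _ _ (4 * expR (- (w / 2)))).
    have -> : - w = - (w / 2) + - (w / 2) by field.
    rewrite expRD -mulrA mulrC ler_wpM2r ?expR_ge0//.
    rewrite expRN mulrC ler_pdivrMr ?expR_gt0//.
    by have := expR_ge1Dx (w / 2); lra.
  by rewrite ler_pM2l// -expRD ler_expR; lra.
have h3 : xi * expR (- (b / 2) * xi) <= 4 / b * expR (- (b / 4) * xi).
  have -> : - (b / 2) * xi = - (b / 4 * xi) + - (b / 4) * xi by field.
  rewrite expRD mulrA ler_wpM2r ?expR_ge0// expRN ler_pdivrMr ?expR_gt0//.
  rewrite -ler_pdivrMl ?divr_gt0// invf_div.
  by have := expR_ge1Dx (b / 4 * xi); lra.
have xi00 : 0 <= `|h| * `|k| * xi by rewrite mulr_ge0 // ltW.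
apply: le_trans (ler_wpM2r xi00 h2) _.
have -> : 4 * (expR 1 * expR (- (b / 2) * xi)) * (`|h| * `|k| * xi) =
  4 * expR 1 * (`|h| * `|k|) * (xi * expR (- (b / 2) * xi)) by ring.
have -> : 16 * expR 1 * (`|h| * `|k|) / b * expR (- (b / 4) * xi) =
  4 * expR 1 * (`|h| * `|k|) * (4 / b * expR (- (b / 4) * xi)) by field; rewrite gt_eqF.
by rewrite ler_wpM2l// mulr_ge0// mulr_ge0 ?expR_ge0.
Qed.

Let continuous_d_amplitude t h k xi : 0 < xi ->
  {for xi, continuous (d_amplitude t h k)}.
Proof.
move=> xi0.
have cM (f g : R -> R) : {for xi, continuous f} -> {for xi, continuous g} ->
  {for xi, continuous (fun z : R => f z * g z)} by move=> cf cg; exact: cvgM.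
have cD (f g : R -> R) : {for xi, continuous f} -> {for xi, continuous g} ->
  {for xi, continuous (fun z : R => f z + g z)} by move=> cf cg; exact: cvgD.
have cC (c : R) : {for xi, continuous (fun=> c)} by exact: cvg_cst.
have dx (c : R) : is_derive xi 1 (fun z => z * c) c.
  by under eq_fun do rewrite mulrC; exact: is_derive_lin.
have csin (c : R) : {for xi, continuous (fun z : R => sin (z * c))}.
  exact: is_derive1_continuous (is_derive1_chain (is_derive_sin _) (dx c)).
have ccos (c : R) : {for xi, continuous (fun z : R => cos (z * c))}.
  exact: is_derive1_continuous (is_derive1_chain (is_derive_cos _) (dx c)).
have ccf := is_derive1_continuous (is_derive_stable_cf t xi0).
have cp := is_derive1_continuous (is_derive1_powR (al - 1) xi0).
apply: (cD); apply: (cM) => //.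
- by apply: (cM) => //; apply: (cM) => //; exact: (cM).
- by apply: (cM) => //; exact: (cM).
- apply: (cM) => //; apply: (cD); apply: (cM) => //; exact: (cM).
Qed.

(** Integration by parts against the primitive [P^-1 * sin (xi * P)] of
[cos (xi * P)], where [P] is the difference of the midpoints.  The derivative of
the amplitude is of order [|h k| xi] instead of [|h k| xi^2], whence one power of
[rate t] less and the factor [1 / |P|].  The boundary terms vanish, at 0 because
of the product of sines and at infinity because of [stable_cf t]. *)
Lemma mixed_difference_stable_density_osc_le t x y x' y' : 0 < t ->
  (x + y) / 2 - (x' + y') / 2 != 0 ->
  `|mixed_difference (stable_density t) x y x' y'| <=
  64 * expR 1 / pi * (`|x - y| * `|x' - y'|) / rate t ^+ 2 /
    `|(x + y) / 2 - (x' + y') / 2|.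
Proof.
move=> t0; rewrite mixed_difference_stable_density//.
have b0 := rate_gt0 t0; set b := rate t in b0 *.
set h := x - y; set k := x' - y'; set P := (_ - _) => P0.
have nP0 : 0 < `|P| by rewrite normr_gt0.
have mp : measurable pos by exact: measurable_itv.
pose F xi := stable_cf t xi * prod_sin h k xi * (P^-1 * sin (xi * P)).
pose u xi := d_amplitude t h k xi * (P^-1 * sin (xi * P)).
pose v xi := stable_cf t xi * (prod_sin h k xi * cos (xi * P)).
have dx (c xi : R) : is_derive xi 1 (fun z => z * c) c.
  by under eq_fun do rewrite mulrC; exact: is_derive_lin.
have dF xi : 0 < xi -> is_derive xi 1 F (u xi + v xi).
  move=> xi0.
  have -> : u xi + v xi = u xi +
    stable_cf t xi * prod_sin h k xi * (P^-1 * (cos (xi * P) * P)).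
    by congr (_ + _); rewrite /v; field.
  have dcf := is_derive_stable_cf t xi0.
  exact: (is_derive1M (is_derive1M dcf (is_derive_prod_sin h k xi))
    (is_derive1_mull P^-1 (is_derive1_chain (is_derive_sin _) (dx P xi)))).
have csin xi : {for xi, continuous (fun z : R => P^-1 * sin (z * P))}.
  exact: is_derive1_continuous
    (is_derive1_mull P^-1 (is_derive1_chain (is_derive_sin _) (dx P xi))).
have ccos xi : {for xi, continuous (fun z : R => cos (z * P))}.
  exact: is_derive1_continuous (is_derive1_chain (is_derive_cos _) (dx P xi)).
have cu xi : 0 < xi -> {for xi, continuous u}.
  by move=> xi0; apply: cvgM; [exact: continuous_d_amplitude|exact: csin].
have cv xi : 0 < xi -> {for xi, continuous v}.
  move=> xi0; apply: cvgM.
    exact: is_derive1_continuous (is_derive_stable_cf t xi0).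
  apply: cvgM; last exact: ccos.
  exact: is_derive1_continuous (is_derive_prod_sin h k xi).
have mu_ : measurable_fun pos u.
  apply: open_continuous_measurable_fun; first exact: interval_open.
  by move=> xi; rewrite inE/= in_itv/= andbT; exact: cu.
have mv : measurable_fun pos v.
  apply: open_continuous_measurable_fun; first exact: interval_open.
  by move=> xi; rewrite inE/= in_itv/= andbT; exact: cv.
have hk0 : 0 <= `|h| * `|k| by rewrite mulr_ge0.
have b40 : 0 < b / 4 by rewrite divr_gt0.
have [] := @Rintegral_exp_dominated R u
  (16 * expR 1 * (`|h| * `|k|) / b / `|P|) (b / 4) b40 mu_.
  move=> xi xi0; rewrite /u mulrAC normrM.
  apply: ler_pM => //; first exact: d_amplitude_le.
  by rewrite normrM normfV ler_piMr ?invr_ge0// sin_max.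
move=> iu uK.
have [] := @Rintegral_exp_dominated R v
  (`|h| * `|k| * (8 * expR 1 / b ^+ 2)) (b / 2) (divr_gt0 b0 (ltr0Sn _ _)) mv.
  move=> xi xi0; rewrite normrM (gtr0_norm (stable_cf_gt0 _ _)) normrM.
  apply: (@le_trans _ _ (stable_cf t xi * (`|h| * `|k| * xi ^+ 2))).
    rewrite ler_wpM2l ?(ltW (stable_cf_gt0 _ _))//.
    apply: le_trans (prod_sin_le h k xi0).
    by rewrite ler_piMr ?cos_max.
  rewrite mulrC -!mulrA ler_wpM2l// ler_wpM2l// !mulrA.
  exact: stable_cf_sqr_le.
move=> iv _.
have Fle xi : 0 < xi -> `|F xi| <= `|h| * `|k| / `|P| * (xi ^+ 2 * stable_cf t xi).
  move=> xi0; rewrite /F 2!normrM (normrM P^-1) normfV.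
  rewrite (gtr0_norm (stable_cf_gt0 _ _)).
  have -> : `|h| * `|k| / `|P| * (xi ^+ 2 * stable_cf t xi) =
    stable_cf t xi * (`|h| * `|k| * xi ^+ 2) * (`|P|^-1 * 1) by ring.
  rewrite ler_pM ?mulr_ge0 ?invr_ge0 ?(ltW (stable_cf_gt0 _ _))//.
    by rewrite ler_wpM2l ?(ltW (stable_cf_gt0 _ _))//; exact: prod_sin_le.
  by rewrite ler_wpM2l ?invr_ge0// sin_max.
have K0 : 0 <= `|h| * `|k| / `|P| by rewrite divr_ge0.
have Iuv : \int[mu]_(xi in pos) (u xi + v xi) = 0 - 0.
  apply: (@Rintegral_0y_primitive _ _ _ _ F) => //.
  - by move=> xi xi0; apply: cvgD; [exact: cu|exact: cv].
  - exact: (@integrableD _ _ _ mu pos mp _ _ iu iv).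
  - apply/norm_cvg0P.
    apply: (@squeeze_cvgr _ _ _ _ (fun=> 0) (fun xi => `|h| * `|k| / `|P| * xi ^+ 2)).
    + near=> xi; rewrite normr_ge0/=.
      have xi0 : 0 < xi by near: xi; exact: nbhs_right_gt.
      apply: le_trans (Fle _ xi0) _; rewrite ler_wpM2l// ler_piMr ?sqr_ge0//.
      by rewrite /stable_cf expR_le1 mulNr oppr_le0 mulr_ge0 ?powR_ge0// ltW.
    + exact: cvg_cst.
    + have e : 0 = `|h| * `|k| / `|P| * 0 ^+ 2 by rewrite expr0n mulr0.
      rewrite [X in _ --> X]e; apply: cvg_at_right_filter.
      by apply: cvgMr; exact: exprn_continuous.
  - apply/norm_cvg0P.
    apply: (@squeeze_cvgr _ _ _ _ (fun=> 0) (fun xi => `|h| * `|k| / `|P| *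
      (8 * expR 1 / b ^+ 2 * expR (- (b / 2) * xi)))).
    + near=> xi; rewrite normr_ge0/=.
      have xi0 : 0 < xi by near: xi; exact: nbhs_pinfty_gt.
      apply: le_trans (Fle _ xi0) _; rewrite ler_wpM2l//.
      exact: stable_cf_sqr_le.
    + exact: cvg_cst.
    + have e : 0 = `|h| * `|k| / `|P| * (8 * expR 1 / b ^+ 2 * 0) by rewrite !mulr0.
      rewrite [X in _ --> X]e; do 2 apply: cvgMr.
      by apply: expRNM_cvg0; rewrite divr_gt0.
have IvE : \int[mu]_(xi in pos) v xi = - \int[mu]_(xi in pos) u xi.
  by move: Iuv; rewrite (@RintegralD _ _ _ mu pos u v mp iu iv); lra.
rewrite normrM gtr0_norm ?invr_gt0 ?pi_gt0// [X in `|X|]IvE normrN.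
rewrite mulrC -ler_pdivlMr ?invr_gt0 ?pi_gt0//; apply: le_trans uK _.
move: (pi_gt0 R); move: (pi : R) => q q0.
rewrite le_eqVlt; apply/orP; left; apply/eqP; field.
by rewrite !gt_eqF.
Unshelve. all: by end_near. Qed.

(** With [v = rate t / |P|] the two preceding bounds are [1] and [v] times a
common factor, and [min 1 v <= v^de]. *)
Lemma mixed_difference_stable_density_interp t x y x' y' de : 0 < t ->
  (x + y) / 2 - (x' + y') / 2 != 0 -> 0 <= de <= 1 ->
  `|mixed_difference (stable_density t) x y x' y'| <=
  64 * expR 1 / pi * (`|x - y| * `|x' - y'|) / rate t ^+ 3 *
    (rate t / `|(x + y) / 2 - (x' + y') / 2|) `^ de.
Proof.
move=> t0 P0 /andP[de0 de1]; have b0 := rate_gt0 t0.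
have H1 := mixed_difference_stable_density_le x y x' y' t0.
have H2 := mixed_difference_stable_density_osc_le t0 P0.
move: H1 H2; move: (mixed_difference _ _ _ _ _) => m.
set b := rate t in b0 *; set P := (_ - _) in P0 *.
set K := `|x - y| * `|x' - y'|.
have nP0 : 0 < `|P| by rewrite normr_gt0.
have K0 : 0 <= 64 * expR 1 / pi * K.
  by rewrite mulr_ge0 ?mulr_ge0 ?invr_ge0 ?pi_ge0 ?expR_ge0.
move=> H1 H2.
have v0 : 0 < b / `|P| by rewrite divr_gt0.
have [v1|v1] := leP 1 (b / `|P|).
  apply: (le_trans H1); apply: (@le_trans _ _ (64 * expR 1 / pi * K / b ^+ 3 * 1)).
    rewrite mulr1 ler_wpM2r ?invr_ge0 ?exprn_ge0 ?(ltW b0)//.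
    rewrite ler_wpM2r ?mulr_ge0// ler_wpM2r ?invr_ge0 ?pi_ge0//.
    by rewrite ler_wpM2r ?expR_ge0// ler_nat.
  rewrite ler_wpM2l//; first by rewrite divr_ge0// exprn_ge0// ltW.
  by rewrite -(powRr0 (b / `|P|)) ler_powR.
apply: (le_trans H2).
rewrite (_ : _ / b ^+ 2 / `|P| = 64 * expR 1 / pi * K / b ^+ 3 * (b / `|P|)).
  rewrite ler_wpM2l ?divr_ge0 ?exprn_ge0 ?(ltW b0)//.
  by rewrite ger1_powR// v0 ltW.
move: (pi_gt0 R); move: (pi : R) => q q0; field.
by rewrite !gt_eqF.
Qed.

Lemma mixed_difference_stable_density_diag_ge0 t x y : 0 < t ->
  0 <= mixed_difference (stable_density t) x y x y.
Proof.
move=> t0; rewrite mixed_difference_stable_density// mulr_ge0 ?invr_ge0 ?pi_ge0//.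
apply: Rintegral_ge0 => xi _.
rewrite subrr mulr0 cos0 mulr1 mulr_ge0 ?(ltW (stable_cf_gt0 _ _))//.
by rewrite -mulrA mulr_ge0// -expr2 sqr_ge0.
Qed.

(** The integrand is nonnegative, so the integral may be restricted to
the frequencies from [1 / (2 b)] to [1 / b], where [b = rate t].  There [stable_cf t >= e^(-1)], and the
arguments [xi * (x - y) / 2] are at most [1/2], so the sines are bounded
below by their arguments. *)
Lemma mixed_difference_stable_density_diag_ge t x y : 0 < t ->
  `|x - y| <= rate t ->
  (16 * expR 1 * pi)^-1 * (x - y) ^+ 2 / rate t ^+ 3 <=
  mixed_difference (stable_density t) x y x y.
Proof.
move=> t0 hb; have b0 := rate_gt0 t0; set b := rate t in b0 hb *.
rewrite mixed_difference_stable_density// subrr.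
set h := x - y in hb *.
pose f xi := stable_cf t xi * (prod_sin h h xi * cos (xi * 0)).
have f0 xi : 0 <= f xi.
  rewrite /f mulr0 cos0 mulr1 mulr_ge0 ?(ltW (stable_cf_gt0 _ _))//.
  by rewrite /prod_sin -mulrA mulr_ge0// -expr2 sqr_ge0.
have intf : mu.-integrable pos (EFin \o f).
  apply: (@Rintegral_exp_dominated R f (`|h| * `|h| * (8 * expR 1 / b ^+ 2))
    (b / 2) (divr_gt0 b0 (ltr0Sn _ _)) _ _).1.
    apply: measurable_funM; first exact: measurable_stable_cf.
    exact: measurable_prod_sin.
  move=> xi xi0; rewrite normrM (gtr0_norm (stable_cf_gt0 _ _)) normrM.
  apply: (@le_trans _ _ (stable_cf t xi * (`|h| * `|h| * xi ^+ 2))).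
    rewrite ler_wpM2l ?(ltW (stable_cf_gt0 _ _))//.
    apply: le_trans (prod_sin_le h h xi0).
    by rewrite ler_piMr ?cos_max.
  rewrite mulrC -!mulrA ler_wpM2l// ler_wpM2l// !mulrA.
  exact: stable_cf_sqr_le.
pose c := (expR 1)^-1 * (h ^+ 2 / (8 * b ^+ 2)).
have c0 : 0 <= c.
  rewrite /c mulr_ge0 ?invr_ge0 ?expR_ge0// divr_ge0 ?sqr_ge0// mulr_ge0//.
  by rewrite exprn_ge0// ltW.
have fc xi : (2 * b)^-1 <= xi <= b^-1 -> c <= f xi.
  move=> /andP[xi1 xi2].
  have xi0 : 0 < xi by apply: lt_le_trans xi1; rewrite invr_gt0 mulr_gt0.
  rewrite /c /f mulr0 cos0 mulr1; apply: ler_pM.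
  - by rewrite invr_ge0 expR_ge0.
  - by rewrite divr_ge0 ?sqr_ge0// mulr_ge0// exprn_ge0// ltW.
  - rewrite -expRN ler_expR mulNr lerN2 -{1}(powR_rate t0).
    rewrite -powRM ?(ltW b0) ?(ltW xi0)//.
    have bxi1 : b * xi <= 1 by rewrite -ler_pdivlMl// mulr1.
    apply: le_trans (ge0_ler_powR (ltW al_gt0) _ _ bxi1) _; rewrite ?nnegrE//.
      by rewrite mulr_ge0 ?ltW.
    by rewrite powR1.
  - rewrite /prod_sin -mulrA -expr2.
    have w1 : `|xi * (h / 2)| <= 2^-1.
      rewrite !normrM normfV (gtr0_norm xi0) (@gtr0_norm _ 2)// mulrA.
      rewrite -[leRHS]mul1r ler_wpM2r ?invr_ge0//.
      apply: (@le_trans _ _ (b^-1 * b)); first exact: ler_pM (ltW xi0) _ _ _.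
      by rewrite mulVf ?gt_eqF.
    have := sqr_sin_ge w1.
    have : ((2 * b)^-1) ^+ 2 <= xi ^+ 2.
      by rewrite ler_sqr ?nnegrE ?(ltW xi0)// invr_ge0 mulr_ge0 ?ltW.
    move=> xx; have := ler_wpM2r (sqr_ge0 h) xx.
    have -> : h ^+ 2 / (8 * b ^+ 2) = ((2 * b)^-1) ^+ 2 * h ^+ 2 / 2.
      by field; rewrite gt_eqF.
    move: (((2 * b)^-1) ^+ 2) => bb; move: (sin _) => ss; lra.
have Ic : (c / (2 * b))%:E = (\int[mu]_(xi in `[((2 * b)^-1)%R, (b^-1)%R]) c%:E)%E.
  rewrite integral_cst//= lebesgue_measure_itv/= lte_fin.
  have -> : (2 * b)^-1 < b^-1.
    by rewrite ltf_pV2 ?posrE ?mulr_gt0// ltr_pMl// ltr1n.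
  by rewrite -EFinB -EFinM; congr EFin; field; rewrite gt_eqF.
have IcE : c / (2 * b) <= \int[mu]_(xi in pos) f xi.
  rewrite -lee_fin /Rintegral fineK; last exact: integrable_fin_num intf.
  rewrite Ic; apply: (@le_trans _ _ (\int[mu]_(xi in `[((2 * b)^-1)%R, (b^-1)%R]) (f xi)%:E)%E).
    apply: ge0_le_integral => //.
    apply/measurable_EFinP; apply: measurable_funM; first exact: measurable_stable_cf.
    exact: measurable_prod_sin.
  apply: ge0_subset_integral => //.
  - exact: measurable_int intf.
  - by move=> xi _; rewrite lee_fin.
  - move=> xi; rewrite /= !in_itv/= andbT => /andP[+ _].
    by apply: lt_le_trans; rewrite invr_gt0 mulr_gt0.
apply: (@le_trans _ _ (pi^-1 * (c / (2 * b)))).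
  rewrite /c; move: (pi_gt0 R) (expR_gt0 (1:R)); move: (pi : R) (expR 1) => q e q0 e0.
  by rewrite le_eqVlt; apply/orP; left; apply/eqP; field; rewrite !gt_eqF.
by rewrite ler_wpM2l ?invr_ge0 ?pi_ge0.
Qed.

End stable_kernel.

(** * Integrals depending on a parameter, reflections *)
Section dominated_Rintegral.
Context d (T : measurableType d) (R : realType).
Variable mu : {measure set T -> \bar R}.

Lemma Rintegral_dominated_cvg (D : set T) (f_ : nat -> T -> R) (f g : T -> R) :
  measurable D -> (forall n, measurable_fun D (f_ n)) -> measurable_fun D f ->
  {ae mu, forall x, D x -> f_ ^~ x @ \oo --> f x} ->
  (forall n x, D x -> `|f_ n x| <= g x) ->
  mu.-integrable D (EFin \o g) ->
  \int[mu]_(x in D) f_ n x @[n --> \oo] --> \int[mu]_(x in D) f x.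
Proof.
move=> mD mf_ mf f_f fg ig.
have [] := @dominated_convergence _ _ R mu D mD (fun n => EFin \o f_ n) (EFin \o f)
  (EFin \o g) _ _ _ ig _.
- by move=> n; apply/measurable_EFinP; exact: mf_.
- exact/measurable_EFinP.
- apply: filterS f_f => x h Dx /=.
  by apply: cvg_EFin; [exact: nearW|exact: h].
- by apply: aeW => x n Dx /=; rewrite lee_fin fg.
move=> intf _ cvgI.
apply: fine_cvg; rewrite fineK//; exact: integrable_fin_num intf.
Qed.

End dominated_Rintegral.

Section parametric_measurability.
Context d1 d2 (T1 : measurableType d1) (T2 : measurableType d2) (R : realType).
Variable m : {sigma_finite_measure set T2 -> \bar R}.

Lemma measurable_parametric_integral (g : T1 * T2 -> \bar R) :
  measurable_fun [set: T1 * T2] g ->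
  measurable_fun [set: T1] (fun t => (\int[m]_y g (t, y))%E).
Proof.
move=> mg.
rewrite (_ : (fun t => _) = ((fun t => \int[m]_y g^\+ (t, y)) \-
                            (fun t => \int[m]_y g^\- (t, y)))%E).
  apply: emeasurable_funB.
  - by apply: (measurable_fun_fubini_tonelli_F (g^\+)%E) => //; exact: measurable_funepos.
  - by apply: (measurable_fun_fubini_tonelli_F (g^\-)%E) => //; exact: measurable_funeneg.
apply/funext => t /=; rewrite integralE.
by congr (_ - _)%E; apply: eq_integral => y _; rewrite ?funeposE ?funenegE.
Qed.

Lemma measurable_parametric_Rintegral (D : set T2) (g : T1 * T2 -> R) :
  measurable D -> measurable_fun [set: T1 * T2] g ->
  measurable_fun [set: T1] (fun t => \int[m]_(y in D) g (t, y)).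
Proof.
move=> mD mg; apply: measurableT_comp => //.
rewrite [X in measurable_fun _ X](_ : _ =
    (fun t => \int[m]_y (g (t, y) * \1_D y)%:E)%E).
  apply: (measurable_parametric_integral (g := fun p => (g p * \1_D p.2)%:E)).
  apply/measurable_EFinP; apply: measurable_funM => //.
  have m1 : measurable_fun setT (\1_D : T2 -> R) by exact: measurable_indic.
  exact: (measurableT_comp m1 measurable_snd).
apply/funext => t; rewrite [LHS]integral_mkcond; apply: eq_integral => y _.
by rewrite patchE indicE; case: ifPn => _; rewrite ?mulr1 ?mulr0.
Qed.

End parametric_measurability.

Section reflection.
Variable R : realType.
Notation mu := (@lebesgue_measure R).

Lemma measurable_subrl (x : R) : measurable_fun [set: R] (fun z : R => x - z).
Proof. by apply: measurable_funB. Qed.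

Lemma pushforward_reflection (x : R) (A : set R) : measurable A ->
  pushforward mu (fun z : R => (x - z : measurableTypeR R)) A = mu A.
Proof.
move=> mA; apply/esym; apply: lebesgue_measure_unique => //=.
  exact: measurable_subrl.
move=> mx _ [[a b]] _ <-.
rewrite /pushforward (_ : _ @^-1` _ = `[x - b, x - a[%classic); last first.
  by apply/seteqP; split => z /=; rewrite !in_itv/= => /andP[? ?]; apply/andP; split; lra.
rewrite !lebesgue_measure_itv/= !lte_fin.
have -> : (x - b < x - a) = (a < b) by rewrite ltrD2l ltrN2.
by case: ifPn => // _; rewrite -!EFinD; congr EFin; ring.
Qed.

Lemma ge0_integral_reflection (x : R) (f : R -> \bar R) :
  measurable_fun [set: R] f -> (forall z, 0 <= f z)%E ->
  (\int[mu]_z f (x - z)%R = \int[mu]_z f z)%E.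
Proof.
move=> mf f0.
transitivity (\int[pushforward mu (fun z : R => (x - z : measurableTypeR R)%R)]_z f z)%E.
  have := @ge0_integral_pushforward _ _ (measurableTypeR R) (measurableTypeR R) R
    (fun z => x - z) (measurable_subrl x) mu setT f measurableT mf (fun z _ => f0 z).
  by rewrite preimage_setT => ->.
apply: eq_measure_integral; first exact: measurable_subrl.
by move=> mx A mA _; exact: pushforward_reflection.
Qed.

Lemma integrable_reflection (x : R) (f : R -> R) :
  mu.-integrable [set: R] (EFin \o f) ->
  mu.-integrable [set: R] (EFin \o (fun z => f (x - z))).
Proof.
move=> /integrableP[mf intf].
have mf' : measurable_fun setT f by apply/measurable_EFinP.
apply/integrableP; split.
  by apply/measurable_EFinP; apply: (measurableT_comp mf'); exact: measurable_subrl.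
rewrite (_ : (fun z => _) = (fun z => (abse \o (EFin \o f)) (x - z)))//.
rewrite (ge0_integral_reflection x (f := abse \o (EFin \o f)))//.
  exact: measurableT_comp.
by move=> z; exact: abse_ge0.
Qed.

Lemma integral_reflection (x : R) (f : R -> R) :
  mu.-integrable [set: R] (EFin \o f) ->
  (\int[mu]_z (f (x - z))%:E = \int[mu]_z (f z)%:E)%E.
Proof.
move=> /measurable_int mf.
rewrite [LHS]integralE [RHS]integralE; congr (_ - _)%E.
- rewrite -[RHS](ge0_integral_reflection x).
  + by apply: eq_integral => z _; rewrite !funeposE.
  + exact: measurable_funepos.
  + by move=> z; exact: funepos_ge0.
- rewrite -[RHS](ge0_integral_reflection x).
  + by apply: eq_integral => z _; rewrite !funenegE.
  + exact: measurable_funeneg.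
  + by move=> z; exact: funeneg_ge0.
Qed.

End reflection.

(** * Fourier inversion and Parseval's identity *)
Section fourier_inversion.
Variable R : realType.
Notation mu := (@lebesgue_measure R).
Notation pos := (`]0%R, +oo[%classic : set R).
Variables (f A : R -> R) (x : R).
Hypothesis intf : mu.-integrable [set: R] (EFin \o f).
Hypothesis intA : mu.-integrable pos (EFin \o A).
(* The transform of [f] at [xi], with phases counted from the point [x], is the
   real number [A xi]. *)
Hypothesis f_cos : forall xi : R, 0 < xi ->
  \int[mu]_z (f z * cos (xi * (x - z))) = A xi.
Hypothesis f_sin : forall xi : R, 0 < xi ->
  \int[mu]_z (f z * sin (xi * (x - z))) = 0.

Definition fourier_inverse y :=
  pi^-1 * \int[mu]_(xi in `]0, +oo[) (A xi * cos (xi * (y - x))).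

Let mpos : measurable pos. Proof. exact: measurable_itv. Qed.

Let measurable_cos_diff (y : R) :
  measurable_fun [set: R * R] (fun p : R * R => cos (p.2 * (y - p.1))).
Proof.
apply: (measurableT_comp (@measurable_cos R)); apply: measurable_funM => //.
by apply: measurable_funB.
Qed.

Let integrable_fcos (y xi : R) :
  mu.-integrable [set: R] (EFin \o (fun z => f z * cos (xi * (y - z)))).
Proof.
apply: (@integrable_mulr_bounded _ _ _ mu setT _ _ 1 measurableT intf).
- apply: (measurableT_comp (@measurable_cos R)); apply: measurable_funM => //.
  exact: measurable_subrl.
- by move=> z _; exact: cos_max.
Qed.

Let integrable_fsin (y xi : R) :
  mu.-integrable [set: R] (EFin \o (fun z => f z * sin (xi * (y - z)))).
Proof.
apply: (@integrable_mulr_bounded _ _ _ mu setT _ _ 1 measurableT intf).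
- apply: (measurableT_comp (@measurable_sin R)); apply: measurable_funM => //.
  exact: measurable_subrl.
- by move=> z _; exact: sin_max.
Qed.

Lemma fourier_transform_shift y xi : 0 < xi ->
  \int[mu]_z (f z * cos (xi * (y - z))) = A xi * cos (xi * (y - x)).
Proof.
move=> xi0.
transitivity (\int[mu]_z (cos (xi * (y - x)) * (f z * cos (xi * (x - z))) -
                          sin (xi * (y - x)) * (f z * sin (xi * (x - z))))).
  apply: eq_Rintegral => z _.
  have -> : xi * (y - z) = xi * (y - x) + xi * (x - z) by ring.
  by rewrite cosD; ring.
rewrite (@RintegralB _ _ _ mu setT (fun z => _ * (f z * cos _)) (fun z => _ * (f z * sin _)))//.
- rewrite (@RintegralZl _ _ _ mu setT (fun z => f z * cos _))//.
  rewrite (@RintegralZl _ _ _ mu setT (fun z => f z * sin _))//.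
  by rewrite f_cos// f_sin// mulr0 subr0 mulrC.
- exact: (@integrableZl _ _ _ mu setT measurableT _ _ (integrable_fcos x xi)).
- exact: (@integrableZl _ _ _ mu setT measurableT _ _ (integrable_fsin x xi)).
Qed.

(** Moving the transform from one factor to the other (Fubini). *)
Lemma fourier_pairing (B : R -> R) (y : R) : mu.-integrable pos (EFin \o B) ->
  \int[mu]_z (f z * \int[mu]_(xi in pos) (B xi * cos (xi * (y - z)))) =
  \int[mu]_(xi in pos) (B xi * (A xi * cos (xi * (y - x)))).
Proof.
move=> intB.
rewrite (@Rintegral_fubini_bounded _ _ _ _ R mu mu setT pos f B
  (fun p => cos (p.2 * (y - p.1))) 1 measurableT mpos intf intB) /=.
- apply: eq_Rintegral => xi; rewrite inE/= in_itv/= andbT => xi0.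
  by rewrite fourier_transform_shift.
- exact: measurable_cos_diff y.
- by move=> p; exact: cos_max.
Qed.

Let measurable_poisson (eta : R) : 0 < eta ->
  measurable_fun [set: R * R]
    (fun p : R * R => eta / (eta ^+ 2 + (p.1 - p.2) ^+ 2)).
Proof.
move=> eta0.
have mphi : measurable_fun [set: R] (fun u : R => eta / (eta ^+ 2 + u ^+ 2)).
  apply: continuous_measurable_fun => u.
  have q0 : eta ^+ 2 + u ^+ 2 != 0 by rewrite gt_eqF// ltr_pwDl ?sqr_ge0// exprn_gt0.
  apply: cvgM; first exact: cvg_cst.
  apply: cvgV => //; apply: cvgD; first exact: cvg_cst.
  exact: exprn_continuous.
by apply: (measurableT_comp mphi); exact: measurable_funB.
Qed.

Let poisson_le (eta u : R) : 0 < eta -> `|eta / (eta ^+ 2 + u ^+ 2)| <= eta^-1.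
Proof.
move=> eta0; have e20 : 0 < eta ^+ 2 by rewrite exprn_gt0.
have q0 : 0 < eta ^+ 2 + u ^+ 2 by rewrite ltr_pwDl ?sqr_ge0.
rewrite ger0_norm ?divr_ge0 ?(ltW eta0) ?(ltW q0)//.
rewrite ler_pdivrMr// mulrDr expr2 mulrA mulVf ?gt_eqF// mul1r lerDl.
by rewrite mulr_ge0 ?sqr_ge0// invr_ge0 ltW.
Qed.

(** The exponential weights make the inversion integral of the smoothed function
exact; the inversion theorem follows by letting [eta] tend to 0 on both sides
after integrating over an interval. *)
Lemma poisson_smoothing (eta y : R) : 0 < eta ->
  \int[mu]_z (f z * (eta / (eta ^+ 2 + (y - z) ^+ 2))) =
  \int[mu]_(xi in pos) (expR (- eta * xi) * A xi * cos (xi * (y - x))).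
Proof.
move=> eta0; have := fourier_pairing y (integrable_expR eta0).
under eq_Rintegral do rewrite Rintegral_expR_cos//.
by move=> ->; apply: eq_Rintegral => xi _; rewrite mulrA.
Qed.

(* The integral from [a] to [b] of the Poisson kernel centred at [z]; as [eta]
   tends to 0 it converges boundedly to [pi] times the indicator of [z] being
   between [a] and [b], except at the end points. *)
Let atan_diff (eta a b z : R) :=
  atan (eta^-1 * (b - z)) - atan (eta^-1 * (a - z)).

Let integral_poisson (eta a b z : R) : 0 < eta -> a < b ->
  \int[mu]_(y in `[a, b]) (eta / (eta ^+ 2 + (y - z) ^+ 2)) = atan_diff eta a b z.
Proof.
move=> eta0 ab.
have dat (y : R) : is_derive y 1 (fun y => atan (eta^-1 * (y - z)))
   (eta / (eta ^+ 2 + (y - z) ^+ 2)).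
  have d1 : is_derive y 1 (fun y : R => eta^-1 * (y - z)) eta^-1.
    rewrite -[X in is_derive _ _ _ X]mulr1; apply: is_derive1_mull.
    by rewrite -[X in is_derive _ _ _ X]addr0; exact: is_derive1D.
  have q0 : 0 < eta ^+ 2 + (y - z) ^+ 2 by rewrite ltr_pwDl ?sqr_ge0// exprn_gt0.
  have -> : eta / (eta ^+ 2 + (y - z) ^+ 2) =
    (1 + (eta^-1 * (y - z)) ^+ 2)^-1 * eta^-1.
    have -> : 1 + (eta^-1 * (y - z)) ^+ 2 = (eta ^+ 2 + (y - z) ^+ 2) / eta ^+ 2.
      by field; rewrite gt_eqF.
    by move: (eta ^+ 2 + _) q0 => q q0; field; rewrite !gt_eqF.
  exact: is_derive1_chain (is_derive1_atan _) d1.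
rewrite /Rintegral (@continuous_FTC2 _ _ (fun y => atan (eta^-1 * (y - z))))//.
- apply: continuous_subspaceT => y.
  have q0 : eta ^+ 2 + (y - z) ^+ 2 != 0.
    by rewrite gt_eqF// ltr_pwDl ?sqr_ge0// exprn_gt0.
  apply: cvgM; first exact: cvg_cst.
  apply: cvgV => //; apply: cvgD; first exact: cvg_cst.
  have d1 : is_derive y 1 (fun y : R => y - z) 1.
    by rewrite -[X in is_derive _ _ _ X]addr0; exact: is_derive1D.
  exact: is_derive1_continuous (is_derive1M d1 d1).
- split.
  + by move=> y _; have [] := dat y.
  + by apply: cvg_at_right_filter; exact: is_derive1_continuous (dat a).
  + by apply: cvg_at_left_filter; exact: is_derive1_continuous (dat b).
- by move=> y _; rewrite derive1E; have := dat y => H; rewrite derive_val.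
Qed.

Let integrable_itv_cst (a b c : R) : mu.-integrable `[a, b] (EFin \o (fun=> c)).
Proof.
apply: continuous_compact_integrable; first exact: segment_compact.
by apply: continuous_subspaceT => y; exact: cvg_cst.
Qed.

Let smoothed_itv (eta a b : R) : 0 < eta -> a < b ->
  \int[mu]_z (f z * atan_diff eta a b z) =
  \int[mu]_(xi in pos) (expR (- eta * xi) * A xi *
     \int[mu]_(y in `[a, b]) cos (xi * (y - x))).
Proof.
move=> eta0 ab.
have := @Rintegral_fubini_bounded _ _ _ _ R mu mu `[a, b]%classic setT (fun=> 1) f
  (fun p => eta / (eta ^+ 2 + (p.1 - p.2) ^+ 2)) eta^-1 (measurable_itv _) measurableT
  (integrable_itv_cst a b 1) intf (measurable_poisson eta0) (fun p => poisson_le _ eta0).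
rewrite /=; under eq_Rintegral do rewrite mul1r poisson_smoothing//.
under [X in _ = X]eq_Rintegral do under eq_Rintegral do rewrite mul1r.
under [X in _ = X]eq_Rintegral do rewrite integral_poisson//.
move=> <-.
have ieA : mu.-integrable pos (EFin \o (fun xi => expR (- eta * xi) * A xi)).
  have := @integrable_mulr_bounded _ _ _ mu pos A (fun xi => expR (- eta * xi)) 1
    mpos intA (@measurable_expRl R eta pos).
  under [X in EFin \o X]eq_fun do rewrite mulrC.
  apply; move=> xi; rewrite /= in_itv/= andbT => xi0.
  by rewrite ger0_norm ?expR_ge0// expR_le1 mulNr oppr_le0 mulr_ge0 ?ltW.
have mc : measurable_fun [set: R * R] (fun p : R * R => cos (p.2 * (p.1 - x))).
  apply: (measurableT_comp (@measurable_cos R)); apply: measurable_funM => //.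
  by apply: measurable_funB.
have := @Rintegral_fubini_bounded _ _ _ _ R mu mu `[a, b]%classic pos (fun=> 1)
  (fun xi => expR (- eta * xi) * A xi)
  (fun p => cos (p.2 * (p.1 - x))) 1 (measurable_itv _) mpos
  (integrable_itv_cst a b 1) ieA mc (fun p => cos_max _).
rewrite /=; under [X in X = _ -> _]eq_Rintegral do rewrite mul1r.
by under [X in _ = X -> _]eq_Rintegral do under eq_Rintegral do rewrite mul1r.
Qed.

Let atan_scaled_cvg (c : R) : c != 0 ->
  atan (((n.+1%:R : R)^-1)^-1 * c) @[n --> \oo] --> (if 0 < c then pi / 2 else - (pi / 2)).
Proof.
have pcvg (e : R) : 0 < e -> atan (((n.+1%:R : R)^-1)^-1 * e) @[n --> \oo] --> pi / 2.
  move=> e0; under eq_fun do rewrite invrK.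
  have h : atan (y * e) @[y --> +oo] --> pi / 2.
    apply: (@cvg_comp _ _ _ _ _ _ (pinfty_nbhs R)); last exact: cvgy_atan.
    exact: (gt0_cvgMly e0).
  apply: ((cvg_pinftyP _ _).1 h); have := @cvgr_idn R.
  by rewrite -cvg_shiftS.
case: ltgtP => // c0 _; first exact: pcvg.
have -> : c = - - c by rewrite opprK.
under eq_fun do rewrite mulrN atanN.
by apply: cvgN; apply: pcvg; rewrite oppr_gt0.
Qed.

Let ae_neq (c : R) : {ae mu, forall z, z != c}.
Proof.
exists [set c]; split => //; first exact: lebesgue_measure_set1.
by move=> z /= /negP; rewrite negbK => /eqP.
Qed.

Let smoothed_itv_cvgl (a b : R) : a < b ->
  \int[mu]_z (f z * atan_diff n.+1%:R^-1 a b z) @[n --> \oo] -->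
  pi * \int[mu]_(z in `[a, b]) f z.
Proof.
move=> ab.
have mf : measurable_fun setT f by apply/measurable_EFinP; exact: measurable_int intf.
have -> : pi * \int[mu]_(z in `[a, b]) f z = \int[mu]_z (f z * (pi * \1_`[a, b] z)).
  have iab : mu.-integrable `[a, b] (EFin \o f) by exact: integrableS intf.
  rewrite -(@RintegralZl _ _ _ mu _ f pi _ iab)// Rintegral_mkcond.
  apply: eq_Rintegral => z _; rewrite patchE indicE; case: ifPn => _.
    by rewrite mulr1 mulrC.
  by rewrite !mulr0.
have mat (c eta : R) : measurable_fun setT (fun z : R => atan (eta^-1 * (c - z))).
  apply: (measurableT_comp (f := @atan R)).
    by apply: continuous_measurable_fun => z; exact: continuous_atan.
  by apply: measurable_funM => //; exact: measurable_subrl.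
apply: (@Rintegral_dominated_cvg _ _ _ mu setT _ _ (fun z => `|f z| * pi)) => //.
- move=> n; apply: measurable_funM => //.
  by apply: measurable_funB; exact: mat.
- by apply: measurable_funM => //; apply: measurable_funM => //; exact: measurable_indic.
- have FF := ae_filter_ringOfSetsType mu.
  apply: filterS2 (ae_neq a) (ae_neq b) => z za zb _.
  apply: cvgM; first exact: cvg_cst.
  have az0 : a - z != 0 by rewrite subr_eq0 eq_sym.
  have bz0 : b - z != 0 by rewrite subr_eq0 eq_sym.
  have -> : pi * \1_`[a, b] z = (if 0 < b - z then pi / 2 else - (pi / 2)) -
      (if 0 < a - z then pi / 2 else - (pi / 2)) :> R.
    rewrite indicE !subr_gt0.
    have [zb'|zb'] := ltP z b; have [za'|za'] := ltP z a.
    - by rewrite memNset ?mulr0 ?subrr//= in_itv/= leNgt za'.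
    - by rewrite mem_set/= ?in_itv/= ?za' ?ltW//; rewrite mulr1; field.
    - by have := lt_le_trans za' (ltW ab); rewrite ltNge zb'.
    - rewrite memNset/=; first by rewrite mulr0 subrr.
      by rewrite in_itv/= => /andP[_]; rewrite leNgt lt_neqAle zb' eq_sym zb.
  by apply: cvgB; exact: atan_scaled_cvg.
- move=> n z _; rewrite normrM ler_wpM2l// /atan_diff.
  set u := _ * _; set v := _ * _.
  have := atan_gtNpi2 u; have := atan_ltpi2 u.
  have := atan_gtNpi2 v; have := atan_ltpi2 v.
  by rewrite ler_norml; move: (atan u) (atan v) => p q; lra.
- have := @integrableZr _ _ _ mu setT measurableT pi _ (integrable_norm intf).
  by [].
Qed.

Lemma normr_fourier_inverse_le y :
  `|fourier_inverse y| <= pi^-1 * \int[mu]_(xi in pos) `|A xi|.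
Proof.
rewrite /fourier_inverse normrM ger0_norm ?invr_ge0 ?pi_ge0//.
rewrite ler_wpM2l ?invr_ge0 ?pi_ge0//.
have mA : measurable_fun pos A by apply/measurable_EFinP; exact: measurable_int intA.
apply: (@normr_Rintegral_le _ _ _ mu pos _ _ mpos).
- apply: measurable_funM => //; apply: (measurableT_comp (@measurable_cos R)).
  exact: measurable_funM.
- by move=> xi _; rewrite normrM ler_piMr// cos_max.
- exact: integrable_norm.
Qed.

Lemma measurable_fourier_inverse : measurable_fun [set: R] fourier_inverse.
Proof.
apply: measurable_funM => //.
have mA : measurable_fun pos A by apply/measurable_EFinP; exact: measurable_int intA.
have mA0 : measurable_fun setT (A \_ pos) by apply/(measurable_restrictT _ mpos).
rewrite (_ : (fun y => _) = (fun y => \int[mu]_(xi in pos) ((A \_ pos) xi * cos (xi * (y - x))))).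
  apply: (@measurable_parametric_Rintegral _ _ R _ R mu pos
    (fun p => (A \_ pos) p.2 * cos (p.2 * (p.1 - x))) mpos).
  apply: measurable_funM; first exact: (measurableT_comp mA0).
  apply: (measurableT_comp (@measurable_cos R)); apply: measurable_funM => //.
  by apply: measurable_funB.
by apply/funext => y; apply: eq_Rintegral => xi hxi; rewrite patchE hxi.
Qed.

Let integrable_fourier_inverse (a b : R) :
  mu.-integrable `[a, b] (EFin \o fourier_inverse).
Proof.
apply: (@integrable_dominated _ _ _ mu `[a, b]%classic _
  (fun=> pi^-1 * \int[mu]_(xi in pos) `|A xi|) (measurable_itv _)).
- by apply: measurable_funTS; exact: measurable_fourier_inverse.
- by move=> y _; exact: normr_fourier_inverse_le.
- exact: integrable_itv_cst.
Qed.

Let measurable_cos_itv (a b : R) (D : set R) :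
  measurable_fun D (fun xi => \int[mu]_(y in `[a, b]) cos (xi * (y - x))).
Proof.
apply: measurable_funTS.
apply: (@measurable_parametric_Rintegral _ _ R _ R mu `[a, b]%classic
  (fun p => cos (p.1 * (p.2 - x)))); first exact: measurable_itv.
apply: (measurableT_comp (@measurable_cos R)); apply: measurable_funM => //.
by apply: measurable_funB.
Qed.

Let cos_itv_le (a b xi : R) : a < b ->
  `|\int[mu]_(y in `[a, b]) cos (xi * (y - x))| <= b - a.
Proof.
move=> ab; apply: (@le_trans _ _ (\int[mu]_(y in `[a, b]) (cst 1 y))).
  apply: (@normr_Rintegral_le _ _ _ mu `[a, b]%classic _ _ (measurable_itv _)).
  - apply: (measurableT_comp (@measurable_cos R)); apply: measurable_funM => //.
    by apply: measurable_funB.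
  - by move=> y _; exact: cos_max.
  - exact: integrable_itv_cst.
rewrite (@Rintegral_cst _ _ _ mu _ (measurable_itv _)) mul1r.
by rewrite /= lebesgue_measure_itv/= lte_fin ab/=.
Qed.

Let smoothed_itv_cvgr (a b : R) : a < b ->
  \int[mu]_(xi in pos) (expR (- n.+1%:R^-1 * xi) * A xi *
     \int[mu]_(y in `[a, b]) cos (xi * (y - x))) @[n --> \oo] -->
  pi * \int[mu]_(y in `[a, b]) fourier_inverse y.
Proof.
move=> ab.
have mA : measurable_fun pos A by apply/measurable_EFinP; exact: measurable_int intA.
have mc : measurable_fun [set: R * R] (fun p : R * R => cos (p.2 * (p.1 - x))).
  apply: (measurableT_comp (@measurable_cos R)); apply: measurable_funM => //.
  by apply: measurable_funB.
have -> : pi * \int[mu]_(y in `[a, b]) fourier_inverse y =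
  \int[mu]_(xi in pos) (A xi * \int[mu]_(y in `[a, b]) cos (xi * (y - x))).
  have := @Rintegral_fubini_bounded _ _ _ _ R mu mu `[a, b]%classic pos (fun=> 1)
    A (fun p => cos (p.2 * (p.1 - x))) 1 (measurable_itv _) mpos
    (integrable_itv_cst a b 1) intA mc (fun p => cos_max _).
  rewrite /=; under [X in X = _ -> _]eq_Rintegral do rewrite mul1r.
  under [X in _ = X -> _]eq_Rintegral do under eq_Rintegral do rewrite mul1r.
  move=> <-.
  rewrite -(@RintegralZl _ _ _ mu _ _ pi (measurable_itv _) (integrable_fourier_inverse a b)).
  apply: eq_Rintegral => y _.
  by rewrite /fourier_inverse mulrA divff ?mul1r// gt_eqF ?pi_gt0.
apply: (@Rintegral_dominated_cvg _ _ _ mu pos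
  (fun n xi => expR (- n.+1%:R^-1 * xi) * A xi * \int[mu]_(y in `[a, b]) cos (xi * (y - x)))
  (fun xi => A xi * \int[mu]_(y in `[a, b]) cos (xi * (y - x)))
  (fun xi => `|A xi| * (b - a))) => //.
- move=> n; apply: measurable_funM; last exact: measurable_cos_itv.
  by apply: measurable_funM => //; exact: measurable_expRl.
- by apply: measurable_funM => //; exact: measurable_cos_itv.
- apply: aeW => xi _; apply: cvgM; last exact: cvg_cst.
  rewrite -[X in _ --> X]mul1r; apply: cvgM; last exact: cvg_cst.
  have e : 1 = expR (- 0 * xi) by rewrite oppr0 mul0r expR0.
  rewrite [X in _ --> X]e; apply: continuous_cvg; first exact: continuous_expR.
  apply: cvgM; last exact: cvg_cst.
  by apply: cvgN; exact: cvg_harmonic.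
- move=> n xi; rewrite /= in_itv/= andbT => xi0.
  rewrite normrM ler_pM ?cos_itv_le// normrM ler_piMl//.
  by rewrite ger0_norm ?expR_ge0// expR_le1 mulNr oppr_le0 mulr_ge0 ?ltW ?invr_gt0.
- have := @integrableZr _ _ _ mu pos mpos (b - a) _ (integrable_norm intA).
  by [].
Qed.

(** Both sides are the limit of the same sequence, the integrals from [a] to
[b] of the Poisson-smoothed function with [eta = 1 / (n + 1)]. *)
Lemma integral_itv_fourier_inverse (a b : R) : a < b ->
  \int[mu]_(z in `[a, b]) f z = \int[mu]_(z in `[a, b]) fourier_inverse z.
Proof.
move=> ab.
have pi0 : (pi : R) != 0 by rewrite gt_eqF ?pi_gt0.
apply: (mulfI pi0).
have cl := smoothed_itv_cvgl ab; have cr := smoothed_itv_cvgr ab.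
have e : (fun n => \int[mu]_z (f z * atan_diff n.+1%:R^-1 a b z)) =
  (fun n => \int[mu]_(xi in pos) (expR (- n.+1%:R^-1 * xi) * A xi *
     \int[mu]_(y in `[a, b]) cos (xi * (y - x)))).
  by apply/funext => n; rewrite smoothed_itv// invr_gt0.
by rewrite e in cl; exact: cvg_unique cl cr.
Qed.

(** The difference of the two functions has zero integral over every segment, so
the Lebesgue differentiation theorem makes it vanish almost everywhere. *)
Lemma fourier_inversion : {ae mu, forall z, f z = fourier_inverse z}.
Proof.
pose D z := f z - fourier_inverse z.
have iD a b : mu.-integrable `[a, b] (EFin \o D).
  have iab : mu.-integrable `[a, b] (EFin \o f) by exact: integrableS intf.
  exact: (@integrableB _ _ _ mu _ (measurable_itv _) _ _ iab (integrable_fourier_inverse a b)).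
have mD : measurable_fun setT D.
  apply: measurable_funB; last exact: measurable_fourier_inverse.
  by apply/measurable_EFinP; exact: measurable_int intf.
have locD : locally_integrable setT D.
  split; [exact: mD|exact: openT|] => K _ cK.
  have [M [_ KM]] := compact_bounded cK.
  have KI : K `<=` `[- (M + 1), M + 1].
    move=> z Kz; rewrite /= in_itv/= -ler_norml.
    by apply: (KM (M + 1)) => //; rewrite ltrDl.
  apply: (@le_lt_trans _ _ (\int[mu]_(z in `[(- (M + 1))%R, (M + 1)%R]) `|(EFin \o D) z|)%E).
    apply: ge0_subset_integral => //.
    - exact: compact_measurable.
    - apply/measurable_EFinP; apply: measurableT_comp => //.
      exact: measurable_funTS.
  by have /integrableP[] := iD (- (M + 1)) (M + 1).
have ID0 (n : nat) y : \int[mu]_(z in `[(- n%:R), y]) D z = 0.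
  have [ny|yn] := ltP (- n%:R) y.
    rewrite (@RintegralB _ _ _ mu _ f fourier_inverse (measurable_itv _)).
    - by rewrite integral_itv_fourier_inverse// subrr.
    - exact: integrableS intf.
    - exact: integrable_fourier_inverse.
  move: yn; rewrite le_eqVlt => /predU1P[->|yn].
    by rewrite set_itv1 Rintegral_set1.
  by rewrite set_itv_ge ?Rintegral_set0// bnd_simp -ltNge.
(* The differentiation theorem is applied on half-lines with a finite left end,
   hence the countable intersection over [n]. *)
have H (n : nat) : {ae mu, forall z, - n%:R < z -> D z = 0}.
  have := @FTC1 R D (BLeft (- n%:R)) (fun y => iD (- n%:R) y) locD.
  apply: filterS; first exact: (ae_filter_ringOfSetsType mu).
  move=> z /= h nz; have [|_ <-] := h; first by rewrite lte_fin.
  rewrite (_ : (fun _ => _) = cst 0); first by rewrite derive1_cst.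
  by apply/funext => y; exact: ID0.
have FF := ae_filter_ringOfSetsType mu.
apply: filterS (ae_foralln H) => z h; apply/eqP; rewrite -subr_eq0; apply/eqP.
apply: (h (Num.truncn `|z|).+1).
by rewrite ltrNl (le_lt_trans (ler_norm _))// normrN truncnS_gt.
Qed.

End fourier_inversion.

Section fourier_parseval.
Variable R : realType.
Notation mu := (@lebesgue_measure R).
Notation pos := (`]0%R, +oo[%classic : set R).

Definition cosine_transform (f A : R -> R) (x : R) :=
  [/\ mu.-integrable [set: R] (EFin \o f), mu.-integrable pos (EFin \o A),
      forall xi : R, 0 < xi -> \int[mu]_z (f z * cos (xi * (x - z))) = A xi &
      forall xi : R, 0 < xi -> \int[mu]_z (f z * sin (xi * (x - z))) = 0].

(** Replacing [f'] by its inversion formula, which is only valid almost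
everywhere, and moving the transform onto [f].  The product is integrable
because [fourier_inverse] is bounded. *)
Lemma fourier_parseval (f A f' A' : R -> R) (x x' : R) :
  cosine_transform f A x -> cosine_transform f' A' x' ->
  mu.-integrable [set: R] (EFin \o (fun z => f z * f' z)) /\
  \int[mu]_z (f z * f' z) =
  pi^-1 * \int[mu]_(xi in pos) (A xi * A' xi * cos (xi * (x - x'))).
Proof.
move=> [intf intA fc fs] [intf' intA' fc' fs'].
have f'E := fourier_inversion intf' intA' fc' fs'.
have mf : measurable_fun setT f by apply/measurable_EFinP; exact: measurable_int intf.
have mf' : measurable_fun setT f' by apply/measurable_EFinP; exact: measurable_int intf'.
have minv := measurable_fourier_inverse x' intA'.
have ae1 : ae_eq mu setT (EFin \o (fun z => f z * f' z))
    (EFin \o (fun z => f z * fourier_inverse A' x' z)).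
  move: f'E; apply: filterS; first exact: (ae_filter_ringOfSetsType mu).
  by move=> z /= -> _.
have i1 : mu.-integrable [set: R] (EFin \o (fun z => f z * fourier_inverse A' x' z)).
  apply: (@integrable_mulr_bounded _ _ _ mu setT _ _
    (pi^-1 * \int[mu]_(xi in pos) `|A' xi|) measurableT intf minv).
  by move=> z _; exact: normr_fourier_inverse_le.
have mff' : measurable_fun setT (EFin \o (fun z => f z * f' z)).
  by apply/measurable_EFinP; exact: measurable_funM.
split.
  apply/integrableP; split => //.
  move/integrableP : i1 => [_].
  rewrite (@ge0_ae_eq_integral _ _ _ mu setT
    (abse \o (EFin \o (fun z => f z * f' z)))
    (abse \o (EFin \o (fun z => f z * fourier_inverse A' x' z)))) //.
  - exact: measurableT_comp.
  - by apply: measurableT_comp => //; apply/measurable_EFinP; exact: measurable_funM.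
  - by move=> z _; exact: abse_ge0.
  - by move=> z _; exact: abse_ge0.
  - have FF := ae_filter_ringOfSetsType mu.
    by apply: filterS ae1 => z /= h _; have [->] := h I.
transitivity (\int[mu]_z (f z * fourier_inverse A' x' z)).
  congr fine; apply: ae_eq_integral => //.
  by apply/measurable_EFinP; exact: measurable_funM.
have fpr := fourier_pairing intf fc fs x' intA'.
have pi0 : (pi : R) != 0 by rewrite gt_eqF ?pi_gt0.
have e : \int[mu]_z (f z * \int[mu]_(xi in pos) (A' xi * cos (xi * (x' - z)))) =
    pi * \int[mu]_z (f z * fourier_inverse A' x' z).
  rewrite -(@RintegralZl _ _ _ mu setT _ pi measurableT i1).
  apply: eq_Rintegral => z _; rewrite mulrCA; congr (_ * _).
  rewrite /fourier_inverse mulrA divff// mul1r.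
  apply: eq_Rintegral => xi _; congr (_ * _).
  by rewrite -cosN; congr cos; ring.
rewrite -[LHS](mulKf pi0) -e fpr.
congr (_ * _); apply: eq_Rintegral => xi _.
rewrite mulrCA mulrA; congr (_ * _).
by rewrite -cosN; congr cos; ring.
Qed.

End fourier_parseval.

(** * The singular kernel of the noise in time *)
Section iterated_integrals.
Context d1 d2 (T1 : measurableType d1) (T2 : measurableType d2) (R : realType).
Variable m1 : {sigma_finite_measure set T1 -> \bar R}.
Variable m2 : {sigma_finite_measure set T2 -> \bar R}.
Implicit Types f g : T1 * T2 -> R.

Let measurable_section f x : measurable_fun [set: T1 * T2] f ->
  measurable_fun [set: T2] (fun y => (f (x, y))%:E).
Proof.
move=> mf; apply/measurable_EFinP.
by apply: measurableT_comp mf _; exact: measurable_pair1.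
Qed.

Lemma measurable_iterated f : measurable_fun [set: T1 * T2] f ->
  measurable_fun [set: T1] (fun x => \int[m2]_y (f (x, y))%:E)%E.
Proof.
move=> mf; apply: (measurable_parametric_integral m2 (g := EFin \o f)).
exact/measurable_EFinP.
Qed.

Lemma ge0_iterated_le f g : measurable_fun [set: T1 * T2] f ->
  measurable_fun [set: T1 * T2] g ->
  (forall p, 0 <= f p) -> (forall p, f p <= g p) ->
  (\int[m1]_x \int[m2]_y (f (x, y))%:E <= \int[m1]_x \int[m2]_y (g (x, y))%:E)%E.
Proof.
move=> mf mg f0 fg.
apply: ge0_le_integral => //.
- by move=> x _; apply: integral_ge0 => y _; rewrite lee_fin.
- exact: measurable_iterated.
- exact: measurable_iterated.
move=> x _; apply: ge0_le_integral => //.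
- by move=> y _; rewrite lee_fin.
- exact: measurable_section.
- exact: measurable_section.
- by move=> y _; rewrite lee_fin.
Qed.

Lemma ge0_iteratedD f g : measurable_fun [set: T1 * T2] f ->
  measurable_fun [set: T1 * T2] g ->
  (forall p, 0 <= f p) -> (forall p, 0 <= g p) ->
  (\int[m1]_x \int[m2]_y (f (x, y) + g (x, y))%:E =
  \int[m1]_x \int[m2]_y (f (x, y))%:E + \int[m1]_x \int[m2]_y (g (x, y))%:E)%E.
Proof.
move=> mf mg f0 g0.
rewrite -ge0_integralD//.
- apply: eq_integral => x _; rewrite -ge0_integralD//.
  + by move=> y _; rewrite lee_fin.
  + exact: measurable_section.
  + by move=> y _; rewrite lee_fin.
  + exact: measurable_section.
- by move=> x _; apply: integral_ge0 => y _; rewrite lee_fin.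
- exact: measurable_iterated.
- by move=> x _; apply: integral_ge0 => y _; rewrite lee_fin.
- exact: measurable_iterated.
Qed.

End iterated_integrals.

(** By Tonelli a function and its transpose have the same integral; a symmetric
integrand can thus be estimated by one that prefers one of the two variables. *)
Lemma symmetric_iterated_le d (T : measurableType d) (R : realType)
    (m : {sigma_finite_measure set T -> \bar R}) (f g : T * T -> R) (L : R) :
  measurable_fun [set: T * T] f -> measurable_fun [set: T * T] g ->
  (forall p, 0 <= f p) -> (forall p, 0 <= g p) ->
  (forall x y, f (x, y) <= g (x, y) + g (y, x)) ->
  (\int[m]_x \int[m]_y (g (x, y))%:E <= L%:E ->
   \int[m]_x \int[m]_y (f (x, y))%:E <= (2 * L)%:E)%E.
Proof.
move=> mf mg f0 g0 fg gL.
pose g' (p : T * T) := g (p.2, p.1).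
have mg' : measurable_fun [set: T * T] g' by exact: (measurableT_comp mg (@measurable_swap _ _ T T)).
apply: (@le_trans _ _ (\int[m]_x \int[m]_y (g (x, y) + g' (x, y))%:E)%E).
  apply: (ge0_iterated_le m m mf (measurable_funD mg mg')) => //.
  by move=> [x y]; exact: fg.
rewrite ge0_iteratedD//; last by move=> p; exact: g0.
have -> : (\int[m]_x \int[m]_y (g' (x, y))%:E = \int[m]_x \int[m]_y (g (x, y))%:E)%E.
  rewrite (@fubini_tonelli _ _ _ _ R m m (EFin \o g'))//.
  - exact/measurable_EFinP.
  - by move=> p; rewrite lee_fin; exact: g0.
by rewrite -mulr2n mulr_natl mulr2n EFinD leeD.
Qed.

Section time_kernel.
Variables (R : realType) (ga t : R).
Hypotheses (ga0 : ga < 0) (ga1 : -1 < ga) (t0 : 0 < t).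
Notation mu := (@lebesgue_measure R).
Implicit Types (p : R * R) (be r : R).

Definition time_kernel p : R :=
  \1_(`]0, t[%classic : set R) p.1 * \1_(`]0, t[%classic : set R) p.2 *
  `|p.1 - p.2| `^ ga.

Lemma time_kernel_ge0 p : 0 <= time_kernel p.
Proof. by rewrite mulr_ge0 ?powR_ge0// mulr_ge0// indicE ler0n. Qed.

Lemma measurable_time_kernel : measurable_fun [set: R * R] time_kernel.
Proof.
have m1 : measurable_fun setT (\1_(`]0, t[%classic : set R) : R -> R).
  by exact: measurable_indic.
apply: measurable_funM.
  by apply: measurable_funM; [exact: (measurableT_comp m1 measurable_fst)|
    exact: (measurableT_comp m1 measurable_snd)].
have mp : measurable_fun setT (fun x : R => x `^ ga) by exact: measurable_powR.
apply: (measurableT_comp mp); apply: measurableT_comp => //.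
by apply: measurable_funB.
Qed.

Lemma time_kernel_in r r' : 0 < r < t -> 0 < r' < t ->
  time_kernel (r, r') = `|r - r'| `^ ga.
Proof.
by move=> hr hr'; rewrite /time_kernel/= !indicE !mem_set//= ?mul1r ?in_itv.
Qed.

Lemma time_kernel_out r r' : ~~ ((0 < r < t) && (0 < r' < t)) ->
  time_kernel (r, r') = 0.
Proof.
rewrite negb_and => h; rewrite /time_kernel/= !indicE.
have E (z : R) : ~~ (0 < z < t) -> (z \in (`]0, t[%classic : set R)) = false.
  by move=> hz; apply/negbTE; apply: contra hz; rewrite inE/= in_itv.
by case/orP: h => /E ->; rewrite ?mul0r// mulr0 mul0r.
Qed.

Lemma time_kernelC r r' : time_kernel (r, r') = time_kernel (r', r).
Proof. by rewrite /time_kernel/= distrC (mulrC (\1_ _ r)). Qed.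

Let q0 : 0 < ga + 1. Proof. by rewrite -ltrBlDr sub0r. Qed.

Let integral_right_le r : 0 < r < t ->
  (\int[mu]_(r' in `]r, t[) ((r' - r) `^ ga)%:E <=
   ((t - r) `^ (ga + 1) / (ga + 1))%:E)%E.
Proof.
move=> /andP[r0 rt]; have [h _] := integral_powR_le rt q0.
by move: h; rewrite addrK.
Qed.

Let integral_left_le r : 0 < r < t ->
  (\int[mu]_(r' in `]0%R, r[) ((r - r') `^ ga)%:E <=
   (r `^ (ga + 1) / (ga + 1))%:E)%E.
Proof.
move=> /andP[r0 rt]; have [_ h] := integral_powR_le r0 q0.
by move: h; rewrite addrK subr0.
Qed.

(** By symmetry one may take [r < r'].  Then [(t - r) + (t - r') >= t - r], the
integral over [r'] gives [(t - r)^(ga + 1) / (ga + 1)], and the remaining power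
[(t - r)^(ga + 1 - be)] is integrable precisely when [be < ga + 2]. *)
Lemma time_kernel_integral_le be : 0 <= be -> be < ga + 2 ->
  (\int[mu]_r \int[mu]_r'
     (time_kernel (r, r') * ((t - r) + (t - r')) `^ (- be))%:E <=
   (2 * (t `^ (ga + 2 - be) / ((ga + 1) * (ga + 2 - be))))%:E)%E.
Proof.
move=> be0 be2; have qb : 0 < ga + 2 - be by rewrite subr_gt0.
have mpow (c : R) : measurable_fun setT (fun x : R => x `^ c) by exact: measurable_powR.
have mK := measurable_time_kernel.
pose g (p : R * R) := if p.1 < p.2 then time_kernel p * (t - p.1) `^ (- be) else 0.
have mg : measurable_fun [set: R * R] g.
  apply: measurable_fun_ifT; first exact: measurable_fun_ltr.
  - apply: measurable_funM => //; apply: (measurableT_comp (mpow _)).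
    by apply: measurable_funB.
  - exact: measurable_cst.
have g0 p : 0 <= g p.
  by rewrite /g; case: ifP => // _; rewrite mulr_ge0 ?powR_ge0 ?time_kernel_ge0.
apply: (@symmetric_iterated_le _ _ R mu
  (fun p => time_kernel p * ((t - p.1) + (t - p.2)) `^ (- be)) g) => //.
- apply: measurable_funM => //; apply: (measurableT_comp (mpow _)).
  by apply: measurable_funD; apply: measurable_funB.
- by move=> p; rewrite mulr_ge0 ?powR_ge0 ?time_kernel_ge0.
- move=> r r'; have [h|h] := boolP ((0 < r < t) && (0 < r' < t)); last first.
    by rewrite /= time_kernel_out// mul0r addr_ge0.
  have {h}/andP[hr hr'] := h; have /andP[r0 rt] := hr; have /andP[r'0 r't] := hr'.
  have dec (u v : R) : 0 < u -> u <= v -> v `^ (- be) <= u `^ (- be).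
    move=> u0 uv; rewrite !powRN lef_pV2 ?posrE ?powR_gt0 ?(lt_le_trans u0)//.
    by rewrite ge0_ler_powR ?nnegrE ?(ltW u0)// (le_trans (ltW u0)).
  have [rr'|r'r|<-] := ltgtP r r'.
  + apply: (@le_trans _ _ (g (r, r'))); last by rewrite lerDl.
    rewrite /g/= rr' ler_wpM2l ?time_kernel_ge0//.
    by apply: dec; rewrite ?subr_gt0// lerDl subr_ge0 ltW.
  + apply: (@le_trans _ _ (g (r', r))); last by rewrite lerDr.
    rewrite /g/= r'r time_kernelC ler_wpM2l ?time_kernel_ge0//.
    by apply: dec; rewrite ?subr_gt0// lerDr subr_ge0 ltW.
  + rewrite time_kernel_in// subrr normr0 powR0 ?lt_eqF// mul0r.
    by rewrite addr_ge0.
have inner r : (\int[mu]_r' (g (r, r'))%:E <=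
    ((fun r => ((t - r) `^ (ga + 2 - be - 1) / (ga + 1))%:E) \_ `]0%R, t[) r)%E.
  rewrite patchE; case: ifPn => [|hr].
    rewrite inE/= in_itv/= => hr; have /andP[r0 rt] := hr.
    rewrite (_ : (fun r' => (g (r, r'))%:E) = (fun r' =>
      (((t - r) `^ (- be))%:E * ((r' - r) `^ ga)%:E)%E) \_ `]r, t[); last first.
      apply/funext => r'; rewrite patchE /g/=; case: ifPn => [rr'|].
        case: ifPn => [|h]; last first.
          rewrite time_kernel_out ?mul0r// hr/=; apply: contra h => /andP[_ r't].
          by rewrite inE/= in_itv/= rr'.
        rewrite inE/= in_itv/= => /andP[_ r't].
        rewrite time_kernel_in// ?r't ?(lt_trans r0)//.
        by rewrite distrC gtr0_norm ?subr_gt0// mulrC EFinM.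
      by rewrite -leNgt => r'r; rewrite memNset//= in_itv/= => /andP[]; rewrite ltNge r'r.
    rewrite -integral_mkcond ge0_integralZl//; last 3 first.
    - apply/measurable_EFinP; apply: measurable_funTS.
      by apply: (measurableT_comp (mpow ga)); apply: measurable_funB.
    - by move=> r' _; rewrite lee_fin powR_ge0.
    - by rewrite lee_fin powR_ge0.
    apply: le_trans.
      by apply: lee_wpmul2l; [rewrite lee_fin powR_ge0|exact: integral_right_le].
    rewrite -EFinM lee_fin mulrA -powRD; last first.
      by rewrite implybE (gt_eqF (_ : 0 < t - r)) ?orbT// subr_gt0.
    rewrite le_eqVlt; apply/orP; left; apply/eqP.
    by congr (_ `^ _ / _); ring.
  rewrite (_ : (fun r' => (g (r, r'))%:E) = (fun=> 0%E)) ?integral0//.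
  apply/funext => r'; rewrite /g; case: ifP => // _.
  rewrite time_kernel_out ?mul0r//; apply: contra hr => /andP[hr _].
  by rewrite inE/= in_itv.
apply: (@le_trans _ _ (\int[mu]_(r in `]0%R, t[) ((t - r) `^ (ga + 2 - be - 1) / (ga + 1))%:E)%E).
  rewrite [leRHS]integral_mkcond; apply: ge0_le_integral => //.
  - by move=> r _; apply: integral_ge0 => r' _; rewrite lee_fin.
  - exact: (@measurable_iterated _ _ _ _ R mu).
  - apply/(measurable_restrictT _ (measurable_itv _)); apply/measurable_EFinP.
    apply: measurable_funM => //; apply: measurable_funTS.
    by apply: (measurableT_comp (mpow _)); apply: measurable_funB.
under eq_integral do rewrite mulrC EFinM.
rewrite ge0_integralZl//; last 3 first.
- apply/measurable_EFinP; apply: measurable_funTS.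
  by apply: (measurableT_comp (mpow _)); apply: measurable_funB.
- by move=> r _; rewrite lee_fin powR_ge0.
- by rewrite lee_fin invr_ge0 ltW.
have [_ h] := integral_powR_le t0 qb.
apply: le_trans.
  by apply: lee_wpmul2l; [rewrite lee_fin invr_ge0 ltW|exact: h].
rewrite -EFinM lee_fin subr0 le_eqVlt; apply/orP; left; apply/eqP.
by field; rewrite !gt_eqF.
Qed.

Lemma time_kernel_section_le r : 0 < r < t ->
  (\int[mu]_r' (time_kernel (r, r'))%:E <=
    (2 * (t `^ (ga + 1) / (ga + 1)))%:E)%E.
Proof.
move=> hr; have /andP[r0 rt] := hr.
have mpow (c : R) : measurable_fun setT (fun x : R => x `^ c) by exact: measurable_powR.
pose f1 := (fun r' => ((r - r') `^ ga)%:E) \_ `]0%R, r[.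
pose f2 := (fun r' => ((r' - r) `^ ga)%:E) \_ `]r, t[.
have mf1 : measurable_fun setT f1.
  apply/(measurable_restrictT _ (measurable_itv _)); apply/measurable_EFinP.
  apply: measurable_funTS; apply: (measurableT_comp (mpow ga)).
  by apply: measurable_funB.
have mf2 : measurable_fun setT f2.
  apply/(measurable_restrictT _ (measurable_itv _)); apply/measurable_EFinP.
  apply: measurable_funTS; apply: (measurableT_comp (mpow ga)).
  by apply: measurable_funB.
have f10 z : (0 <= f1 z)%E.
  by rewrite /f1 patchE; case: ifPn => // _; rewrite lee_fin powR_ge0.
have f20 z : (0 <= f2 z)%E.
  by rewrite /f2 patchE; case: ifPn => // _; rewrite lee_fin powR_ge0.
apply: (@le_trans _ _ (\int[mu]_z (f1 z + f2 z))%E).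
  apply: ge0_le_integral => //.
  - by move=> z _; rewrite lee_fin time_kernel_ge0.
  - apply/measurable_EFinP; apply: (measurableT_comp measurable_time_kernel).
    exact: measurable_pair1.
  - exact: emeasurable_funD.
  move=> r' _; have [hr'|hr'] := boolP (0 < r' < t); last first.
    by rewrite time_kernel_out ?hr ?hr//= adde_ge0.
  have /andP[r'0 r't] := hr'; rewrite time_kernel_in//.
  have [rr'|r'r|<-] := ltgtP r r'.
  + apply: (@le_trans _ _ (f2 r')); last by rewrite leeDr.
    rewrite /f2 patchE mem_set/= ?in_itv/= ?rr'//.
    by rewrite distrC gtr0_norm ?subr_gt0.
  + apply: (@le_trans _ _ (f1 r')); last by rewrite leeDl.
    rewrite /f1 patchE mem_set/= ?in_itv/= ?r'0//.
    by rewrite gtr0_norm ?subr_gt0.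
  + rewrite subrr normr0 powR0 ?lt_eqF//.
    by rewrite adde_ge0.
rewrite ge0_integralD// -!integral_mkcond.
apply: le_trans; first by apply: leeD; [exact: integral_left_le|exact: integral_right_le].
rewrite -EFinD lee_fin mulr_natl mulr2n lerD//.
  by rewrite ler_pM2r ?invr_gt0// ge0_ler_powR ?nnegrE ?(ltW q0) ?ltW.
rewrite ler_pM2r ?invr_gt0// ge0_ler_powR ?nnegrE ?(ltW q0) ?(ltW t0)//.
  by rewrite subr_ge0 ltW.
by rewrite gerBl ltW.
Qed.

(** Here the singularity involves one time only, so it is integrated against the
uniformly bounded sections of the kernel; this needs [be < 1]. *)
Lemma time_kernel_integral_lty be : 0 <= be -> be < 1 ->
  (\int[mu]_r \int[mu]_r'
     (time_kernel (r, r') * ((t - r) `^ (- be) + (t - r') `^ (- be)))%:E < +oo)%E.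
Proof.
move=> be0 be1; have qb : 0 < 1 - be by rewrite subr_gt0.
have mpow (c : R) : measurable_fun setT (fun x : R => x `^ c) by exact: measurable_powR.
have mK := measurable_time_kernel.
pose g (p : R * R) := time_kernel p * (t - p.1) `^ (- be).
have mg : measurable_fun [set: R * R] g.
  apply: measurable_funM => //; apply: (measurableT_comp (mpow _)).
  by apply: measurable_funB.
have g0 p : 0 <= g p by rewrite mulr_ge0 ?powR_ge0 ?time_kernel_ge0.
pose c := 2 * (t `^ (ga + 1) / (ga + 1)).
have c0 : 0 <= c by rewrite mulr_ge0// divr_ge0 ?powR_ge0 ?ltW.
apply: (@le_lt_trans _ _ (2 * (c * (t `^ (1 - be) / (1 - be))))%:E); last by rewrite ltry.
apply: (@symmetric_iterated_le _ _ R mu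
  (fun p => time_kernel p * ((t - p.1) `^ (- be) + (t - p.2) `^ (- be))) g) => //.
- apply: measurable_funM => //; apply: measurable_funD;
    by apply: (measurableT_comp (mpow _)); apply: measurable_funB.
- by move=> p; rewrite mulr_ge0 ?addr_ge0 ?powR_ge0 ?time_kernel_ge0.
- by move=> r r'; rewrite /g/= (time_kernelC r' r) -mulrDr.
apply: (@le_trans _ _ (\int[mu]_(r in `]0%R, t[) (c%:E * ((t - r) `^ (1 - be - 1))%:E))%E).
  rewrite [leRHS]integral_mkcond; apply: ge0_le_integral => //.
  - by move=> r _; apply: integral_ge0 => r' _; rewrite lee_fin.
  - exact: (@measurable_iterated _ _ _ _ R mu).
  - apply/(measurable_restrictT _ (measurable_itv _)); apply/measurable_EFinP.
    apply: measurable_funM => //; apply: measurable_funTS.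
    by apply: (measurableT_comp (mpow _)); apply: measurable_funB.
  move=> r _; rewrite patchE; case: ifPn => [|hr].
    rewrite inE/= in_itv/= => hr.
    under eq_integral do rewrite /g/= EFinM.
    rewrite ge0_integralZr//; last 3 first.
    - apply/measurable_EFinP; apply: (measurableT_comp measurable_time_kernel).
      exact: measurable_pair1.
    - by move=> r' _; rewrite lee_fin time_kernel_ge0.
    - by rewrite lee_fin powR_ge0.
    have -> : 1 - be - 1 = - be by ring.
    by apply: lee_wpmul2r; [rewrite lee_fin powR_ge0|exact: time_kernel_section_le].
  rewrite (_ : (fun r' => (g (r, r'))%:E) = (fun=> 0%E)) ?integral0//.
  apply/funext => r'; rewrite /g.
  rewrite time_kernel_out ?mul0r//; apply: contra hr => /andP[hr _].
  by rewrite inE/= in_itv.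
rewrite ge0_integralZl//; last 2 first.
- apply/measurable_EFinP; apply: measurable_funTS.
  by apply: (measurableT_comp (mpow _)); apply: measurable_funB.
- by move=> r _; rewrite lee_fin powR_ge0.
have [_ h] := integral_powR_le t0 qb.
rewrite [leRHS]EFinM; apply: lee_wpmul2l; first by rewrite lee_fin.
by move: h; rewrite subr0.
Qed.

(** Integrating the lower bound over [r'] from [r] to [t] leaves [c / (t - r)],
whose integral from 0 to [t - a] is the logarithm. *)
Lemma iterated_integral_ge_ln (f : R * R -> R) (a c : R) :
  measurable_fun [set: R * R] f -> (forall p, 0 <= f p) -> 0 < a -> a < t ->
  0 <= c ->
  (forall r r', 0 < r -> r <= t - a -> r < r' -> r' < t ->
     c / (t - r) ^+ 2 <= f (r, r')) ->
  ((c * (ln t - ln a))%:E <= \int[mu]_r \int[mu]_r' (f (r, r'))%:E)%E.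
Proof.
move=> mf f0 a0 at_ c0 fc.
have ta0 : 0 < t - a by rewrite subr_gt0.
have dl (r : R) : r < t -> is_derive r 1 (fun r => - c * ln (t - r)) (c / (t - r)).
  move=> rt.
  have -> : c / (t - r) = - c * ((t - r)^-1 * -1) by ring.
  apply: is_derive1_mull; apply: is_derive1_chain.
    by apply: is_derive1_ln; rewrite subr_gt0.
  by rewrite -[X in is_derive _ _ _ X]add0r; exact: is_derive1D.
have cv (r : R) : r < t -> {for r, continuous (fun r : R => c / (t - r))}.
  move=> rt; apply: cvgM; first exact: cvg_cst.
  apply: cvgV; first by rewrite gt_eqF// subr_gt0.
  by apply: cvgB; [exact: cvg_cst|exact: cvg_id].
have lt_t (r : R) : r <= t - a -> r < t by move=> h; rewrite (le_lt_trans h)// gtrBl.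
have I : (\int[mu]_(r in `[0%R, (t - a)%R]) (c / (t - r))%:E = (c * (ln t - ln a))%:E)%E.
  rewrite (@continuous_FTC2 _ _ (fun r => - c * ln (t - r)))//.
  - by rewrite -EFinB subr0 (_ : t - (t - a) = a); [congr EFin|]; ring.
  - apply: continuous_in_subspaceT => r; rewrite inE/= in_itv/= => /andP[_ h].
    by apply: cv; exact: lt_t.
  - split.
    + by move=> r; rewrite in_itv/= => /andP[_ /ltW/lt_t h]; have [] := dl _ h.
    + by apply: cvg_at_right_filter; exact: is_derive1_continuous (dl _ t0).
    + by apply: cvg_at_left_filter; exact: is_derive1_continuous (dl _ (lt_t _ (lexx _))).
  - move=> r; rewrite in_itv/= => /andP[_ /ltW/lt_t h].
    by rewrite derive1E; have := dl _ h => H; rewrite derive_val.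
have mcv : measurable_fun (`]0, t - a]%classic : set R) (EFin \o (fun r : R => c / (t - r))).
  apply/measurable_EFinP; apply: measurable_funS (_ : measurable_fun (`[0, t - a]%classic : set R) _).
  - exact: measurable_itv.
  - by move=> r /=; rewrite !in_itv/= => /andP[/ltW -> ->].
  - apply: subspace_continuous_measurable_fun; first exact: measurable_itv.
    apply: continuous_in_subspaceT => r; rewrite inE/= in_itv/= => /andP[_ h].
    by apply: cv; exact: lt_t.
rewrite -I -integral_itv_obnd_cbnd// [leLHS]integral_mkcond.
apply: ge0_le_integral => //.
- move=> r _; rewrite patchE; case: ifPn => //.
  rewrite inE/= in_itv/= => /andP[_ /lt_t h].
  by rewrite lee_fin divr_ge0// subr_ge0 ltW.
- exact/(measurable_restrictT _ (measurable_itv _)).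
- exact: (@measurable_iterated _ _ _ _ R mu).
move=> r _; rewrite patchE; case: ifPn => [|_]; last first.
  by apply: integral_ge0 => r' _; rewrite lee_fin.
rewrite inE/= in_itv/= => /andP[r0 rta]; have rt := lt_t _ rta.
have tr0 : t - r != 0 by rewrite gt_eqF// subr_gt0.
apply: (@le_trans _ _ (\int[mu]_(r' in `]r, t[) (c / (t - r) ^+ 2)%:E)%E).
  rewrite integral_cst//= lebesgue_measure_itv/= lte_fin rt -EFinB -EFinM lee_fin.
  by rewrite le_eqVlt; apply/orP; left; apply/eqP; field.
rewrite [leLHS]integral_mkcond; apply: ge0_le_integral => //.
- move=> r' _; rewrite patchE; case: ifPn => // _.
  by rewrite lee_fin divr_ge0// sqr_ge0.
- exact/(measurable_restrictT _ (measurable_itv _)).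
- apply/measurable_EFinP; apply: (measurableT_comp mf); exact: measurable_pair1.
move=> r' _; rewrite patchE; case: ifPn => [|_]; last by rewrite lee_fin.
by rewrite inE/= in_itv/= => /andP[rr' r't]; rewrite lee_fin fc.
Qed.

End time_kernel.

(** * The covariance of the mild solution *)
Section mild_solution_covariance.
Variables (R : realType) (al H : R) (G : R -> R -> R).
Hypotheses (al1 : 1 < al) (al2 : al <= 2) (H1 : H < 1) (alH : al * H = 3 / 2).
Hypothesis hG : fundamental_solution al G.
Notation mu := (@lebesgue_measure R).
Notation pos := (`]0%R, +oo[%classic : set R).
Notation ga := (2 * H - 2).
Notation rate s := (s `^ al^-1).

Let al0 : 0 < al. Proof. exact: lt_trans al1. Qed.

(* The form in which the relation between [al] and [H] is used. *)
Let gaE : ga = 3 / al - 2.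
Proof.
have -> : H = 3 / 2 / al by rewrite -alH mulrAC divff ?mul1r// gt_eqF.
by field; rewrite gt_eqF.
Qed.

Let ga0 : ga < 0. Proof. by move: H1; lra. Qed.

Let ga1 : -1 < ga.
Proof.
rewrite gaE; have : 1 < 3 / al by rewrite ltr_pdivlMr// mul1r (le_lt_trans al2)// ltr_nat.
by lra.
Qed.

Lemma cosine_transform_fundamental_solution t x : 0 < t ->
  cosine_transform (fun z => G t (x - z)) (stable_cf al t) x.
Proof.
case: hG => mG iG cG sG t0.
have iGt := iG t t0.
split.
- exact: integrable_reflection.
- exact: integrable_stable_cf.
- move=> xi xi0.
  have ic : mu.-integrable [set: R] (EFin \o (fun w => cos (xi * w) * G t w)).
    have := @integrable_mulr_bounded _ _ _ mu setT _ (fun w => cos (xi * w)) 1 measurableT iGt.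
    under [X in _ -> _ -> is_true (_.-integrable _ (EFin \o X))]eq_fun do rewrite mulrC.
    apply; last by move=> w _; exact: cos_max.
    by apply: (measurableT_comp (@measurable_cos R)); exact: measurable_funM.
  have := integral_reflection x ic; rewrite cG// (gtr0_norm xi0) => h.
  rewrite /Rintegral; under eq_integral do rewrite mulrC.
  by rewrite h.
- move=> xi xi0.
  have ic : mu.-integrable [set: R] (EFin \o (fun w => sin (xi * w) * G t w)).
    have := @integrable_mulr_bounded _ _ _ mu setT _ (fun w => sin (xi * w)) 1 measurableT iGt.
    under [X in _ -> _ -> is_true (_.-integrable _ (EFin \o X))]eq_fun do rewrite mulrC.
    apply; last by move=> w _; exact: sin_max.
    by apply: (measurableT_comp (@measurable_sin R)); exact: measurable_funM.
  have := integral_reflection x ic; rewrite sG// => h.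
  rewrite /Rintegral; under eq_integral do rewrite mulrC.
  by rewrite h.
Qed.

(** The product of the two characteristic functions is the one at time [s + s']. *)
Lemma fundamental_solution_product s s' x x' : 0 < s -> 0 < s' ->
  mu.-integrable [set: R] (EFin \o (fun z => G s (x - z) * G s' (x' - z))) /\
  (\int[mu]_z (G s (x - z) * G s' (x' - z))%:E =
   (stable_density al (s + s') (x - x'))%:E)%E.
Proof.
move=> s0 s'0.
have [i e] := fourier_parseval (cosine_transform_fundamental_solution x s0)
  (cosine_transform_fundamental_solution x' s'0).
split => //; rewrite -[LHS]fineK; last exact: integrable_fin_num i.
congr EFin; rewrite [LHS]e /stable_density; congr (_ * _).
apply: eq_Rintegral => xi _; congr (_ * _).
by rewrite /stable_cf -expRD; congr expR; ring.
Qed.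

Lemma measurable_mild_integrand t x :
  measurable_fun [set: R * R] (mild_integrand G t x).
Proof.
case: hG => mG _ _ _.
apply: measurable_fun_if => //.
- by apply: measurable_and; exact: measurable_fun_ltr.
- rewrite setTI.
  pose phi (p : R * R) := (t - p.1, x - p.2).
  have mphi : measurable_fun [set: R * R] phi.
    by apply/measurable_fun_pairP; split; apply: measurable_funB.
  have mD : measurable [set p : R * R | 0 < p.1].
    have -> : [set p : R * R | 0 < p.1] = fst @^-1` pos.
      by apply/seteqP; split => p /=; rewrite in_itv/= andbT.
    rewrite -[X in measurable X]setTI; apply: measurable_fst => //.
  refine (measurable_comp (g := phi) mD _ mG (measurable_funTS mphi)).
  move=> _ /= [[r z] /= h <-] /=; rewrite subr_gt0.
  by move: h => /andP[].
Qed.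

Lemma stable_density_le s d : 0 < s ->
  `|stable_density al s d| <= pi^-1 * expR 1 * s `^ (- al^-1).
Proof. by move=> s0; rewrite powRN; exact: normr_stable_density_le. Qed.

Let tker t := time_kernel ga t.

Lemma noise_cov_mild t x x' :
  noise_cov H (mild_integrand G t x) (mild_integrand G t x') =
  (\int[mu]_r \int[mu]_r'
    (tker t (r, r') * stable_density al ((t - r) + (t - r')) (x - x'))%:E)%E.
Proof.
apply: eq_integral => r _; apply: eq_integral => r' _.
have [/andP[hr hr']|h] := boolP ((0 < r < t) && (0 < r' < t)).
  rewrite /tker time_kernel_in// /mild_integrand/= hr hr'.
  have /andP[_ rt] := hr; have /andP[_ r't] := hr'.
  have s0 : 0 < t - r by rewrite subr_gt0.
  have s'0 : 0 < t - r' by rewrite subr_gt0.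
  by have [_ ->] := fundamental_solution_product x x' s0 s'0.
rewrite /tker time_kernel_out// mul0r.
rewrite (_ : (fun z => _) = (fun=> 0%E)) ?integral0 ?mule0//.
apply/funext => z; rewrite /mild_integrand/=; move: h; rewrite negb_and.
by case/orP => /negbTE ->; rewrite ?mul0r ?mulr0.
Qed.

(** The kernel [G] is not known to be nonnegative, so the absolute value of its
space correlation is not given by a density.  It is bounded through
[|a b| <= a^2 + b^2] and the value [p (2 s) 0] of the squared norm, of order
[s^(-1/al)], which is integrable in time since [al > 1]. *)
Lemma wiener_integrable_mild t x : 0 < t ->
  wiener_integrable H (mild_integrand G t x).
Proof.
move=> t0; have mf := measurable_mild_integrand t x.
split => //; set f := mild_integrand G t x in mf *.
pose be := al^-1.
have be0 : 0 <= be by rewrite invr_ge0 ltW.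
have be1 : be < 1 by rewrite invf_lt1.
pose C : R := pi^-1 * expR 1.
have C0 : 0 <= C by rewrite mulr_ge0 ?invr_ge0 ?pi_ge0 ?expR_ge0.
pose k (p : R * R) := tker t p * ((t - p.1) `^ (- be) + (t - p.2) `^ (- be)).
have k0 p : 0 <= k p by rewrite mulr_ge0 ?addr_ge0 ?powR_ge0 ?time_kernel_ge0.
have mpow (c : R) : measurable_fun setT (fun x : R => x `^ c) by exact: measurable_powR.
have mk : measurable_fun [set: R * R] k.
  apply: measurable_funM; first exact: measurable_time_kernel.
  by apply: measurable_funD; apply: (measurableT_comp (mpow _)); apply: measurable_funB.
pose q (p : R * R) := ((`|p.1 - p.2| `^ ga)%:E *
  \int[mu]_z (`|f (p.1, z)| * `|f (p.2, z)|)%:E)%E.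
have q0 p : (0 <= q p)%E.
  rewrite mule_ge0 ?lee_fin ?powR_ge0//; apply: integral_ge0 => z _.
  by rewrite lee_fin mulr_ge0.
have mq : measurable_fun [set: R * R] q.
  apply: emeasurable_funM.
    apply/measurable_EFinP; apply: (measurableT_comp (mpow _)).
    by apply: measurableT_comp => //; apply: measurable_funB.
  have m13 : measurable_fun [set: (R * R) * R] (fun w : (R * R) * R => (w.1.1, w.2)).
    apply/measurable_fun_pairP; split; last exact: measurable_snd.
    exact: (measurableT_comp measurable_fst measurable_fst).
  have m23 : measurable_fun [set: (R * R) * R] (fun w : (R * R) * R => (w.1.2, w.2)).
    apply/measurable_fun_pairP; split; last exact: measurable_snd.
    exact: (measurableT_comp measurable_snd measurable_fst).
  have mff : measurable_fun [set: (R * R) * R]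
      (fun w : (R * R) * R => (`|f (w.1.1, w.2)| * `|f (w.1.2, w.2)|)%:E).
    apply/measurable_EFinP; apply: measurable_funM.
      by apply: measurableT_comp => //; exact: (measurableT_comp mf m13).
    by apply: measurableT_comp => //; exact: (measurableT_comp mf m23).
  exact: (@measurable_parametric_integral _ _ (R * R)%type _ R mu _ mff).
have qk p : (q p <= (C * k p)%:E)%E.
  case: p => r r'; rewrite /q /k/=.
  have [/andP[hr hr']|h] := boolP ((0 < r < t) && (0 < r' < t)); last first.
    rewrite /tker time_kernel_out// mul0r mulr0.
    rewrite (_ : (fun z => _) = (fun=> 0%E)) ?integral0 ?mule0//.
    apply/funext => z; rewrite /f /mild_integrand/=; move: h; rewrite negb_and.
    by case/orP => /negbTE ->; rewrite normr0 ?mul0r ?mulr0.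
  rewrite /tker time_kernel_in// mulrCA EFinM.
  apply: lee_wpmul2l; first by rewrite lee_fin powR_ge0.
  have /andP[_ rt] := hr; have /andP[_ r't] := hr'.
  have s0 : 0 < t - r by rewrite subr_gt0.
  have s'0 : 0 < t - r' by rewrite subr_gt0.
  have [i1 e1] := fundamental_solution_product x x s0 s0.
  have [i2 e2] := fundamental_solution_product x x s'0 s'0.
  set s := t - r in s0 i1 e1 *; set s' := t - r' in s'0 i2 e2 *.
  have sq u : 0 < u -> stable_density al (u + u) (x - x) <= C * u `^ (- be).
    move=> u0; apply: (le_trans (ler_norm _)).
    apply: (le_trans (stable_density_le _ (addr_gt0 u0 u0))).
    rewrite ler_wpM2l// !powRN lef_pV2 ?posrE ?powR_gt0 ?addr_gt0//.
    by rewrite ge0_ler_powR ?nnegrE ?addr_ge0 ?(ltW u0)// lerDl ltW.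
  have iG u z : 0 < u -> measurable_fun [set: R] (fun w => G u (z - w)).
    move=> u0; have [i _ _ _] := cosine_transform_fundamental_solution z u0.
    by apply/measurable_EFinP; exact: measurable_int i.
  apply: (@le_trans _ _ (\int[mu]_z (G s (x - z) * G s (x - z) + G s' (x - z) * G s' (x - z))%:E)%E).
    apply: ge0_le_integral => //.
    - have mfr u : measurable_fun [set: R] (fun z => `|f (u, z)|).
        by apply: measurableT_comp => //; apply: (measurableT_comp mf); exact: measurable_pair1.
      by apply/measurable_EFinP; apply: measurable_funM; exact: mfr.
    - apply/measurable_EFinP; apply: measurable_funD; apply: measurable_funM; exact: iG.
    move=> z _; rewrite /f /mild_integrand/= hr hr' lee_fin -/s -/s'.
    rewrite -!expr2 -(real_normK (num_real (G s _))) -(real_normK (num_real (G s' _))).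
    by move: `|G s _| `|G s' _| (normr_ge0 (G s (x - z))) (normr_ge0 (G s' (x - z))) => a b a0 b0; nra.
  have i2' := i2; have i1' := i1.
  rewrite (@integralD_EFin _ _ _ mu setT measurableT (fun z => G s (x - z) * G s (x - z))
    (fun z => G s' (x - z) * G s' (x - z)) i1 i2).
  rewrite e1 e2 -EFinD lee_fin mulrDr lerD//; exact: sq.
have kfin : (\int[mu]_r \int[mu]_r' (C * k (r, r'))%:E < +oo)%E.
  have -> : (\int[mu]_r \int[mu]_r' (C * k (r, r'))%:E = C%:E * \int[mu]_r \int[mu]_r' (k (r, r'))%:E)%E.
    rewrite -ge0_integralZl//; last 2 first.
    - exact: (@measurable_iterated _ _ _ _ R mu).
    - by move=> r _; apply: integral_ge0 => r' _; rewrite lee_fin.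
    apply: eq_integral => r _; rewrite -ge0_integralZl//; last 2 first.
    - by apply/measurable_EFinP; apply: (measurableT_comp mk); exact: measurable_pair1.
    - by move=> r' _; rewrite lee_fin.
  apply: lte_mul_pinfty; rewrite ?lee_fin//.
  exact: time_kernel_integral_lty.
apply: le_lt_trans kfin.
have -> : noise_cov H (Num.norm \o f) (Num.norm \o f) =
  (\int[mu]_r \int[mu]_r' q (r, r'))%E by [].
have mqr r : measurable_fun [set: R] (fun r' => q (r, r')).
  by apply: measurableT_comp mq _; exact: measurable_pair1.
have mkr r : measurable_fun [set: R] (fun r' => C * k (r, r')).
  by apply: measurable_funM => //; apply: measurableT_comp mk _; exact: measurable_pair1.
apply: ge0_le_integral => //.
- by move=> r _; exact: integral_ge0.
- exact: (@measurable_parametric_integral _ _ R _ R mu q mq).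
- apply: (@measurable_iterated _ _ _ _ R mu (fun p => C * k p)).
  exact: measurable_funM.
move=> r _; apply: ge0_le_integral => //; first exact: mqr.
by apply/measurable_EFinP; exact: mkr.
Qed.

Local Open Scope ereal_scope.
Local Notation mu2 := (mu \x mu).
Local Close Scope ereal_scope.

Lemma measurable_stable_density d : measurable_fun [set: R] (fun s => stable_density al s d).
Proof.
apply: measurable_funM => //.
apply: (@measurable_parametric_Rintegral _ _ R _ R mu pos
  (fun p => stable_cf al p.1 p.2 * cos (p.2 * d))); first exact: measurable_itv.
apply: measurable_funM.
  apply: measurableT_comp => //; apply: measurable_funM.
    by apply: measurableT_comp => //; exact: measurable_fst.
  by apply: (measurableT_comp (measurable_powR al)); exact: measurable_snd.
by apply: (measurableT_comp (@measurable_cos R)); exact: measurable_funM.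
Qed.

Definition mild_cov_density t d (p : R * R) :=
  tker t p * stable_density al ((t - p.1) + (t - p.2)) d.

(** The covariance of [u(t, x)] and [u(t, x')] as a function of [d = x - x']. *)
Definition mild_cov t d : R := \int[mu2]_p mild_cov_density t d p.

Lemma measurable_mild_cov_density t d :
  measurable_fun [set: R * R] (mild_cov_density t d).
Proof.
apply: measurable_funM; first exact: measurable_time_kernel.
apply: (measurableT_comp (measurable_stable_density d)).
by apply: measurable_funD; apply: measurable_funB.
Qed.

Lemma tker_normr_le t (g : R -> R) (K be : R) (p : R * R) :
  (forall s, 0 < s -> `|g s| <= K * s `^ (- be)) ->
  `|tker t p * g ((t - p.1) + (t - p.2))| <=
  K * (tker t p * ((t - p.1) + (t - p.2)) `^ (- be)).
Proof.
move=> gK; case: p => r r' /=.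
have [/andP[hr hr']|h] := boolP ((0 < r < t) && (0 < r' < t)); last first.
  by rewrite /tker time_kernel_out// !mul0r normr0 mulr0.
rewrite normrM (ger0_norm (time_kernel_ge0 _ _ _)) mulrCA ler_wpM2l ?time_kernel_ge0//.
have /andP[_ rt] := hr; have /andP[_ r't] := hr'.
by apply: gK; rewrite addr_gt0 ?subr_gt0.
Qed.

Lemma integral_tker_normr_le t (g : R -> R) (K be : R) : 0 < t ->
  measurable_fun [set: R] g -> 0 <= K -> 0 <= be -> be < ga + 2 ->
  (forall s, 0 < s -> `|g s| <= K * s `^ (- be)) ->
  (\int[mu]_r \int[mu]_r' `|(tker t (r, r') * g ((t - r) + (t - r')))%:E| <=
   (K * (2 * (t `^ (ga + 2 - be) / ((ga + 1) * (ga + 2 - be)))))%:E)%E.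
Proof.
move=> t0 mg K0 be0 be2 gK.
have mpow (c : R) : measurable_fun setT (fun x : R => x `^ c) by exact: measurable_powR.
pose k (p : R * R) := tker t p * ((t - p.1) + (t - p.2)) `^ (- be).
have mtt : measurable_fun [set: R * R] (fun p : R * R => (t - p.1) + (t - p.2)).
  by apply: measurable_funD; apply: measurable_funB.
have mk : measurable_fun [set: R * R] k.
  apply: measurable_funM; first exact: measurable_time_kernel.
  exact: (measurableT_comp (mpow _) mtt).
have k0 p : 0 <= k p by rewrite mulr_ge0 ?powR_ge0 ?time_kernel_ge0.
apply: (@le_trans _ _ (\int[mu]_r \int[mu]_r' (K * k (r, r'))%:E)%E).
  apply: (@ge0_iterated_le _ _ _ _ R mu mu
    (fun p => `|tker t p * g ((t - p.1) + (t - p.2))|) (fun p => K * k p)) => //.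
  - apply: measurableT_comp => //; apply: measurable_funM; first exact: measurable_time_kernel.
    exact: (measurableT_comp mg mtt).
  - exact: measurable_funM.
  - by move=> p; exact: tker_normr_le.
have -> : (\int[mu]_r \int[mu]_r' (K * k (r, r'))%:E = K%:E * \int[mu]_r \int[mu]_r' (k (r, r'))%:E)%E.
  rewrite -ge0_integralZl//; last 2 first.
  - exact: (@measurable_iterated _ _ _ _ R mu).
  - by move=> r _; apply: integral_ge0 => r' _; rewrite lee_fin.
  apply: eq_integral => r _; rewrite -ge0_integralZl//; last 2 first.
  - by apply/measurable_EFinP; apply: measurableT_comp mk _; exact: measurable_pair1.
  - by move=> r' _; rewrite lee_fin.
rewrite [leRHS]EFinM; apply: lee_wpmul2l; first by rewrite lee_fin.
exact: time_kernel_integral_le.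
Qed.

Let ga2E : ga + 2 = 3 / al. Proof. by rewrite gaE; ring. Qed.

Lemma integrable_mild_cov_density t d : 0 < t ->
  mu2.-integrable setT (EFin \o mild_cov_density t d).
Proof.
move=> t0.
have mm : measurable_fun [set: R * R] (EFin \o mild_cov_density t d).
  by apply/measurable_EFinP; exact: measurable_mild_cov_density.
refine ((@integrable12ltyP _ _ _ _ R mu mu _ mm).2 _).
have := @integral_tker_normr_le t (fun s => stable_density al s d) (pi^-1 * expR 1) al^-1 t0
  (measurable_stable_density d) _ _ _ _.
move=> h; apply: le_lt_trans; first apply: h.
- by rewrite mulr_ge0 ?invr_ge0 ?pi_ge0 ?expR_ge0.
- by rewrite invr_ge0 ltW.
- by rewrite ga2E ltr_pMl ?invr_gt0// ltr1n.
- by move=> s s0; exact: stable_density_le.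
- by rewrite ltry.
Qed.

Lemma noise_cov_mildE t x x' : 0 < t ->
  noise_cov H (mild_integrand G t x) (mild_integrand G t x') =
  (mild_cov t (x - x'))%:E.
Proof.
move=> t0; have i := integrable_mild_cov_density (x - x') t0.
rewrite noise_cov_mild /mild_cov /Rintegral fineK; last exact: integrable_fin_num i.
exact: (@integral12_prod_meas1 _ _ _ _ R mu mu _ i).
Qed.

Lemma mixed_difference_mild_cov t x y x' y' : 0 < t ->
  mixed_difference (mild_cov t) x y x' y' =
  \int[mu2]_p (tker t p * mixed_difference
    (stable_density al ((t - p.1) + (t - p.2))) x y x' y').
Proof.
move=> t0; rewrite /mixed_difference /mild_cov.
have i d := integrable_mild_cov_density d t0.
rewrite -(@Rintegral_alternating4 _ _ _ mu2 setT _ _ _ _ measurableT (i _) (i _) (i _) (i _)).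
by apply: eq_Rintegral => p _; rewrite /mild_cov_density; ring.
Qed.

Let measurable_mixed x y x' y' : measurable_fun [set: R]
  (fun s => mixed_difference (stable_density al s) x y x' y').
Proof.
apply: measurable_funD; last exact: measurable_stable_density.
by do 2 (apply: measurable_funB; last exact: measurable_stable_density);
  exact: measurable_stable_density.
Qed.

Let mixed_density x y x' y' t (p : R * R) := tker t p *
  mixed_difference (stable_density al ((t - p.1) + (t - p.2))) x y x' y'.

Let measurable_mixed_density x y x' y' t :
  measurable_fun [set: R * R] (mixed_density x y x' y' t).
Proof.
apply: measurable_funM; first exact: measurable_time_kernel.
apply: (measurableT_comp (measurable_mixed x y x' y')).
by apply: measurable_funD; apply: measurable_funB.
Qed.

Let integrable_mixed_density x y x' y' t : 0 < t ->
  mu2.-integrable setT (EFin \o mixed_density x y x' y' t).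
Proof.
move=> t0; have i d := integrable_mild_cov_density d t0.
have := integrableD measurableT (integrableB measurableT
  (integrableB measurableT (i (x - x')) (i (x - y'))) (i (y - x'))) (i (y - y')).
apply: eq_integrable => // p _ /=.
by rewrite -!EFinD /mixed_density /mild_cov_density /mixed_difference; congr EFin; ring.
Qed.

(** The interpolated bound has time singularity [s^(-(3 - de)/al)], and
[ga + 2 - (3 - de)/al = de/al], so [time_kernel_integral_le] applies for every
[de > 0] with a constant of order [1/de]. *)
Lemma normr_mixed_difference_mild_cov_le t x y x' y' de : 0 < t ->
  (x + y) / 2 - (x' + y') / 2 != 0 -> 0 < de <= 1 ->
  `|mixed_difference (mild_cov t) x y x' y'| <=
  64 * expR 1 / pi * (`|x - y| * `|x' - y'|) *
    `|(x + y) / 2 - (x' + y') / 2| `^ (- de) *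
    (2 * (t `^ (de / al) / ((ga + 1) * (de / al)))).
Proof.
move=> t0 P0 /andP[de0 de1]; rewrite mixed_difference_mild_cov//.
set P := (_ - _) in P0 *; set K := 64 * expR 1 / pi * _.
have nP0 : 0 < `|P| by rewrite normr_gt0.
have i := integrable_mixed_density x y x' y' t0.
have K0 : 0 <= K * `|P| `^ (- de).
  rewrite mulr_ge0 ?powR_ge0// mulr_ge0 ?mulr_ge0 ?invr_ge0 ?pi_ge0 ?expR_ge0//.
apply: le_trans (le_normr_Rintegral measurableT i) _.
have in_ := integrable_norm i.
rewrite -lee_fin /Rintegral fineK; last exact: integrable_fin_num in_.
rewrite -[X in (X <= _)%E](@integral12_prod_meas1 _ _ _ _ R mu mu _ in_).
have e : ga + 2 - (3 - de) / al = de / al by rewrite ga2E; field; rewrite gt_eqF.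
have := @integral_tker_normr_le t
  (fun s => mixed_difference (stable_density al s) x y x' y')
  (K * `|P| `^ (- de)) ((3 - de) / al) t0 (measurable_mixed x y x' y') K0 _ _ _.
rewrite e; apply.
- by rewrite divr_ge0 ?(ltW al0)// subr_ge0 (le_trans de1)// ler1n.
- by rewrite -subr_gt0 e divr_gt0.
move=> s s0; have b0 : 0 < rate s by rewrite powR_gt0.
have de01 : 0 <= de <= 1 by rewrite (ltW de0).
apply: le_trans (mixed_difference_stable_density_interp al1 al2 s0 P0 de01) _.
rewrite -/K -/P -(mulrA K) -(mulrA K) ler_wpM2l//.
  by rewrite mulr_ge0 ?mulr_ge0 ?invr_ge0 ?pi_ge0 ?expR_ge0.
rewrite powRM ?invr_ge0 ?(ltW b0)//.
have -> : `|P|^-1 `^ de = `|P| `^ (- de).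
  by rewrite -(powR_inv1 (normr_ge0 P)) -powRrM mulN1r.
rewrite mulrA mulrC ler_wpM2l ?powR_ge0//.
rewrite -(powR_mulrn 3 (ltW b0)) -powRN -powRD; last by rewrite (gt_eqF b0) implybT.
rewrite -powRrM le_eqVlt; apply/orP; left; apply/eqP; congr (_ `^ _).
by field; rewrite gt_eqF.
Qed.

(** For [r < r'] and [|x - y|^al <= t - r], the density at time
[s = (t - r) + (t - r')], which lies between [t - r] and [2 (t - r)],
contributes [(x - y)^2 (t - r)^(-3/al)], and the kernel at least
[(t - r)^ga]; the product is [(x - y)^2 / (t - r)^2] up to a constant. *)
Lemma mixed_difference_mild_cov_diag_ge t x y : 0 < t -> x != y ->
  `|x - y| `^ al < t ->
  (128 * expR 1 * pi)^-1 * (x - y) ^+ 2 * (ln t - al * ln `|x - y|) <=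
  mixed_difference (mild_cov t) x y x y.
Proof.
move=> t0 xy ht; rewrite mixed_difference_mild_cov//.
have h0 : 0 < `|x - y| by rewrite normr_gt0 subr_eq0.
have i := integrable_mixed_density x y x y t0.
have f0 p : 0 <= mixed_density x y x y t p.
  rewrite /mixed_density; case: p => r r' /=.
  have [/andP[hr hr']|h] := boolP ((0 < r < t) && (0 < r' < t)); last first.
    by rewrite /tker time_kernel_out// mul0r.
  have /andP[_ rt] := hr; have /andP[_ r't] := hr'.
  rewrite mulr_ge0 ?time_kernel_ge0// mixed_difference_stable_density_diag_ge0//.
  by rewrite addr_gt0 ?subr_gt0.
rewrite -lee_fin /Rintegral fineK; last exact: integrable_fin_num i.
rewrite -[X in (_ <= X)%E](@integral12_prod_meas1 _ _ _ _ R mu mu _ i).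
rewrite -ln_powR; set a := `|x - y| `^ al in ht *.
have a0 : 0 < a by rewrite powR_gt0.
have pi0 : (0 : R) < pi by exact: pi_gt0.
have e0 : (0 : R) < expR 1 by exact: expR_gt0.
set c := (128 * expR 1 * pi)^-1 * _.
have c0 : 0 <= c by rewrite mulr_ge0 ?sqr_ge0// invr_ge0 !mulr_ge0// ltW.
apply: (@iterated_integral_ge_ln R t t0 _ a c (measurable_mixed_density x y x y t)) => //.
move=> r r' r0 rta rr' r't; have rt := lt_trans rr' r't; have r'0 := lt_trans r0 rr'.
rewrite /mixed_density /tker time_kernel_in ?r0 ?r'0//=.
set s := t - r; set s' := t - r'.
have s0 : 0 < s by rewrite subr_gt0.
have s'0 : 0 < s' by rewrite subr_gt0.
have ss0 : 0 < s + s' by rewrite addr_gt0.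
have as_ : a <= s by rewrite lerBrDl -lerBrDr.
have ss' : s' <= s by rewrite lerD2l lerN2 ltW.
have ia0 : 0 <= al^-1 by rewrite invr_ge0 ltW.
have hrate : `|x - y| <= rate (s + s').
  have -> : `|x - y| = rate a by rewrite -powRrM mulfV ?gt_eqF// powRr1.
  apply: ge0_ler_powR; rewrite ?nnegrE ?(ltW a0) ?(ltW ss0)//.
  by rewrite (le_trans as_)// lerDl ltW.
have h1 := mixed_difference_stable_density_diag_ge al1 ss0 hrate.
have sga : s `^ ga = s `^ (3 / al) / s ^+ 2.
  rewrite gaE powRB; last by rewrite (gt_eqF s0) implybT.
  by rewrite (powR_mulrn 2 (ltW s0)).
have h2 : s `^ ga <= `|r - r'| `^ ga.
  rewrite distrC gtr0_norm ?subr_gt0//.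
  have -> : ga = - (- ga) by rewrite opprK.
  rewrite !(powRN _ (- ga)) lef_pV2 ?posrE ?powR_gt0 ?subr_gt0//.
  apply: ge0_ler_powR; rewrite ?nnegrE ?oppr_ge0 ?(ltW ga0) ?(ltW s0) ?subr_ge0 ?(ltW rr')//.
  by rewrite lerD2r ltW.
(* From [s + s' <= 2 s] and [2^(3/al) <= 8]. *)
have h3 : rate (s + s') ^+ 3 <= 8 * s `^ (3 / al).
  have b0 : 0 <= rate (s + s') by exact: powR_ge0.
  have p3 : 0 <= 3 / al by rewrite divr_ge0// ltW.
  rewrite -(powR_mulrn 3 b0) -powRrM (mulrC al^-1).
  apply: (@le_trans _ _ ((2 * s) `^ (3 / al))).
    apply: ge0_ler_powR; rewrite ?nnegrE ?(ltW ss0) ?(mulr_ge0 _ (ltW s0))//.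
    by rewrite mulr_natl mulr2n lerD2l.
  rewrite powRM ?(ltW s0)// ler_wpM2r ?powR_ge0//.
  apply: (@le_trans _ _ (2 `^ 3%:R)); last by rewrite powR_mulrn// -natrX ler_nat.
  by rewrite ler_powR ?ler1n// ler_pdivrMr// ler_peMr// ltW.
have sp0 : 0 < s `^ (3 / al) by rewrite powR_gt0.
have b30 : 0 < rate (s + s') ^+ 3 by rewrite exprn_gt0// powR_gt0// addr_gt0.
have k0 : 0 <= (16 * expR 1 * pi)^-1 * (x - y) ^+ 2.
  by rewrite mulr_ge0 ?sqr_ge0// invr_ge0 !mulr_ge0// ltW.
apply: (@le_trans _ _ (s `^ ga *
  ((16 * expR 1 * pi)^-1 * (x - y) ^+ 2 / rate (s + s') ^+ 3))).
  rewrite sga /c.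
  apply: (@le_trans _ _ (s `^ (3 / al) / s ^+ 2 *
    ((16 * expR 1 * pi)^-1 * (x - y) ^+ 2 / (8 * s `^ (3 / al))))).
    rewrite le_eqVlt; apply/orP; left; apply/eqP.
    move: (s `^ (3 / al)) sp0 => S S0; move: pi0 e0; move: (pi : R) (expR 1) => q e q0 e0.
    by field; rewrite !gt_eqF.
  rewrite ler_wpM2l ?divr_ge0 ?sqr_ge0 ?(ltW sp0)//.
  rewrite (ler_wpM2l k0)//.
  by rewrite lef_pV2 ?posrE// (mulr_gt0 _ sp0).
apply: ler_pM => //; first exact: powR_ge0.
by rewrite divr_ge0// ltW.
Qed.

End mild_solution_covariance.

(** * Second moments of increments *)
Section increments.
Context d (T : measurableType d) (R : realType) (P : probability T R).

Lemma Lnorm2_sqrt (Z : T -> R) (V : R) : ('E_P[(Z \* Z)%R] = V%:E ->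
  'N[P]_2%:E[EFin \o Z] = (Num.sqrt V)%:E)%E.
Proof.
move=> ZV.
have V0 : 0 <= V.
  by rewrite -lee_fin -ZV expectation_ge0// => w /=; rewrite -expr2 sqr_ge0.
rewrite -powR12_sqrt// -poweR_EFin -ZV unlock [in RHS]unlock /Lnorm/=.
congr poweR; apply: eq_integral => w _ /=.
by rewrite powR_mulrn// -normrX ger0_norm ?sqr_ge0// expr2.
Qed.

Lemma integrable_product (X Y : T -> R) (a b : R) :
  measurable_fun [set: T] X -> measurable_fun [set: T] Y ->
  ('E_P[(X \* X)%R] = a%:E)%E -> ('E_P[(Y \* Y)%R] = b%:E)%E ->
  P.-integrable [set: T] (EFin \o (fun w => X w * Y w)).
Proof.
move=> mX mY XX YY.
have sq (Z : T -> R) c : measurable_fun [set: T] Z -> ('E_P[(Z \* Z)%R] = c%:E)%E ->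
    P.-integrable [set: T] (EFin \o (fun w => Z w * Z w)).
  move=> mZ ZZ; apply/integrableP; split.
    by apply/measurable_EFinP; exact: measurable_funM.
  rewrite (_ : \int[P]_w _ = c%:E)%E ?ltry// -ZZ unlock.
  by apply: eq_integral => w _ /=; rewrite -expr2 ger0_norm ?sqr_ge0.
have := integrableD measurableT (sq X a mX XX) (sq Y b mY YY).
apply: le_integrable => //.
  by apply/measurable_EFinP; exact: measurable_funM.
move=> w _; rewrite lee_fin -!expr2 normrM [leRHS]ger0_norm; last first.
  by rewrite addr_ge0 ?sqr_ge0.
rewrite -(real_normK (num_real (X w))) -(real_normK (num_real (Y w))).
have := sqr_ge0 (`|X w| - `|Y w|); have := normr_ge0 (X w); have := normr_ge0 (Y w).
by nra.
Qed.

Lemma expectation_increments (X : R -> T -> R) (k : R -> R) x y x' y' :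
  (forall z, measurable_fun [set: T] (X z)) ->
  (forall z z', ('E_P[(X z \* X z')%R] = (k (z - z'))%:E)%E) ->
  ('E_P[((X x \- X y) \* (X x' \- X y'))%R] =
   (mixed_difference k x y x' y')%:E)%E.
Proof.
move=> mX Xk.
have i z z' := integrable_product (mX z) (mX z') (Xk z z) (Xk z' z').
have ki z z' : k (z - z') = \int[P]_w (X z w * X z' w).
  by rewrite /Rintegral -[LHS]/(fine (k (z - z'))%:E) -Xk unlock.
rewrite /mixed_difference !ki.
rewrite -(@Rintegral_alternating4 _ _ _ P setT _ _ _ _ measurableT (i _ _) (i _ _) (i _ _) (i _ _)).
rewrite unlock /Rintegral fineK.
  by apply: eq_integral => w _ /=; congr EFin; ring.
have := integrableD measurableT (integrableB measurableT
  (integrableB measurableT (i x x') (i x y')) (i y x')) (i y y').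
by move/(integrable_fin_num measurableT); apply: eq_ind; congr (_ \is a fin_num).
Qed.

End increments.

Lemma expectation_mild_solution d (T : measurableType d) (R : realType)
    (P : probability T R) (al H : R) (W : (R * R -> R) -> {RV P >-> R})
    (G : R -> R -> R) (u : R -> R -> {RV P >-> R}) t x x' :
  1 < al -> al <= 2 -> H < 1 -> al * H = 3 / 2 ->
  wiener_integral H W -> fundamental_solution al G -> mild_solution W G u ->
  0 < t ->
  ('E_P[(u t x \* u t x')%R] = (mild_cov al H t (x - x'))%:E)%E.
Proof.
move=> al1 al2 H1 alH [_ hW] hG hu t0.
have iW z := wiener_integrable_mild al1 al2 H1 alH hG z t0.
rewrite -(noise_cov_mildE al1 al2 H1 alH hG)// -hW//.
rewrite unlock; apply: ae_eq_integral => //.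
- by apply/measurable_EFinP; exact: measurable_funM.
- by apply/measurable_EFinP; exact: measurable_funM.
have FF := ae_filter_ringOfSetsType P.
have := hu t x (ltW t0); have := hu t x' (ltW t0).
by apply: filterS2 => w /= -> -> _.
Qed.

(** * The correlation of increments *)
Section correlation.
Variables (R : realType) (al H : R).
Hypotheses (al1 : 1 < al) (al2 : al <= 2) (H1 : H < 1) (alH : al * H = 3 / 2).

Let al0 : 0 < al. Proof. exact: lt_trans al1. Qed.

Let gap : 0 < 2 * H - 2 + 1.
Proof.
have -> : H = 3 / 2 / al by rewrite -alH mulrAC divff ?mul1r// gt_eqF.
have : 1 < 3 / al by rewrite ltr_pdivlMr// mul1r (le_lt_trans al2)// ltr_nat.
by rewrite (_ : 3 / 2 / al = (3 / al) / 2); [lra | ring].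
Qed.

(** The constant of [mixed_difference_mild_cov_small] for times up to [T]: the one
of [normr_mixed_difference_mild_cov_le] with [t^(de/al)] bounded by [T >= 1]
and [D^(-de)] by [e]. *)
Definition mixed_constant (T : R) : R :=
  128 * expR 1 ^+ 2 * T * al / (pi * (2 * H - 2 + 1)).

Lemma mixed_constant_gt0 T : 0 < T -> 0 < mixed_constant T.
Proof.
move=> T0; rewrite divr_gt0 ?mulr_gt0 ?pi_gt0 ?exprn_gt0 ?expR_gt0//.
Qed.

Lemma midpoint_distance_ge (r rho x y x' y' : R) : 0 < r <= 1 -> rho <= 1 ->
  `|x - y| <= r -> `|x' - y'| <= r -> 2 * r `^ rho <= `|x - x'| ->
  r `^ rho <= `|(x + y) / 2 - (x' + y') / 2|.
Proof.
move=> r01 rho1 xy xy' xx'.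
have r0 : 0 <= r by case/andP: r01 => /ltW.
have := ger1_powR r01 rho1.
set q := r `^ rho in xx' *; set P := (_ - _) => rq.
have : `|x - x'| <= `|P| + `|(x - y) / 2| + `|(x' - y') / 2|.
  rewrite (_ : x - x' = P + (x - y) / 2 - (x' - y') / 2); last by rewrite /P; field.
  by rewrite (le_trans (ler_normB _ _))// lerD2r ler_normD.
rewrite !normrM !(@ger0_norm _ 2^-1)//.
by lra.
Qed.

(** The exponent is [de = 1 / (rho * - ln r)], for which
[(r^rho)^(-de) = e] whatever [r] and [rho] are. *)
Lemma mixed_difference_mild_cov_small T t rho r x y x' y' :
  0 < t <= T -> 1 <= T -> 0 < rho <= 1 -> 0 < r <= 1 -> 1 <= rho * - ln r ->
  `|x - y| <= r -> `|x' - y'| <= r -> 2 * r `^ rho <= `|x - x'| ->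
  `|mixed_difference (mild_cov al H t) x y x' y'| <=
  `|x - y| * `|x' - y'| * (mixed_constant T * (rho * - ln r)).
Proof.
move=> /andP[t0 tT] T1 /andP[rho0 rho1] r01 rL xy xy' xx'.
have r0 : 0 < r by case/andP: r01.
have := midpoint_distance_ge r01 rho1 xy xy' xx'.
set P := (x + y) / 2 - _ => qP.
have q0 : 0 < r `^ rho by rewrite powR_gt0.
have nP0 : 0 < `|P| by exact: lt_le_trans qP.
have P0 : P != 0 by rewrite -normr_gt0.
set L := rho * - ln r in rL *.
have L0 : 0 < L by exact: lt_le_trans rL.
have de0 : 0 < L^-1 by rewrite invr_gt0.
have de1 : L^-1 <= 1 by rewrite invf_le1.
have := normr_mixed_difference_mild_cov_le al1 al2 H1 alH t0 P0.
move=> /(_ L^-1); rewrite de0 => /(_ de1) h.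
apply: le_trans h _.
have Pe : `|P| `^ (- L^-1) <= expR 1.
  have -> : expR 1 = (r `^ rho) `^ (- L^-1).
    rewrite {1}/powR (gt_eqF q0) ln_powR; congr expR.
    rewrite -[rho * ln r]opprK -mulrN -/L mulrNN mulVf// gt_eqF//.
  rewrite !powRN lef_pV2 ?posrE ?powR_gt0//.
  by apply: ge0_ler_powR; rewrite ?nnegrE ?(ltW q0) ?(ltW de0) ?normr_ge0.
have tT1 : t `^ (L^-1 / al) <= T.
  have e0 : 0 <= L^-1 / al by rewrite divr_ge0 ?ltW.
  have e1 : L^-1 / al <= 1 by rewrite ler_pdivrMr// mul1r (le_trans de1)// ltW.
  apply: (@le_trans _ _ (T `^ (L^-1 / al))).
    by apply: ge0_ler_powR; rewrite ?nnegrE ?(ltW t0) ?(le_trans (ltW t0) tT).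
  exact: ler1_powR.
have pi0 : (0 : R) < pi by exact: pi_gt0.
have h0 : 0 <= `|x - y| * `|x' - y'| by rewrite mulr_ge0.
have e0 : (0 : R) < expR 1 by exact: expR_gt0.
have g0 := gap.
have gd0 : 0 < (2 * H - 2 + 1) * (L^-1 / al) by rewrite mulr_gt0// divr_gt0.
apply: (@le_trans _ _ (64 * expR 1 / pi * (`|x - y| * `|x' - y'|) * expR 1 *
  (2 * (T / ((2 * H - 2 + 1) * (L^-1 / al)))))).
  apply: ler_pM.
  - by rewrite mulr_ge0 ?powR_ge0// mulr_ge0// divr_ge0 ?mulr_ge0 ?(ltW e0) ?(ltW pi0).
  - by rewrite mulr_ge0// divr_ge0 ?powR_ge0 ?(ltW gd0).
  - by rewrite ler_wpM2l// mulr_ge0// divr_ge0 ?mulr_ge0 ?(ltW e0) ?(ltW pi0).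
  - by rewrite ler_wpM2l// ler_wpM2r// invr_ge0 ltW.
rewrite le_eqVlt; apply/orP; left; apply/eqP; rewrite /mixed_constant.
move: (2 * H - 2 + 1) g0 {gd0} => g g0; move: (pi : R) pi0 => q' q'0.
by field; rewrite !gt_eqF.
Qed.

(** The smallness of [r] makes [ln t1] negligible: the logarithm
[ln t - al * ln |x - y|] keeps at least half of [al * - ln r]. *)
Lemma mixed_difference_mild_cov_diag_large t1 t r x y :
  0 < t1 -> t1 <= t -> 0 < r < 1 -> 2 * `|ln t1| / al < - ln r ->
  `|x - y| <= r ->
  `|x - y| ^+ 2 * ((128 * expR 1 * pi)^-1 * (al / 2) * - ln r) <=
  mixed_difference (mild_cov al H t) x y x y.
Proof.
move=> t10 t1t /andP[r0 r1] rL xy.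
have [->|neq] := eqVneq x y.
  by rewrite subrr normr0 expr0n/= mul0r /mixed_difference; lra.
have t0 : 0 < t by exact: lt_le_trans t1t.
have h0 : 0 < `|x - y| by rewrite normr_gt0 subr_eq0.
have hr : ln `|x - y| <= ln r by rewrite ler_ln.
have tl : ln t1 <= ln t by rewrite ler_ln.
have lt1 : - ln t1 <= `|ln t1| by rewrite -normrN ler_norm.
have key : 2 * `|ln t1| < al * - ln r by rewrite [ltRHS]mulrC -ltr_pdivrMr.
have alhr : al * ln `|x - y| <= al * ln r by rewrite ler_pM2l.
have alr : 0 <= al * - ln r by apply: le_trans (ltW key); rewrite mulr_ge0.
have hal : `|x - y| `^ al < t.
  rewrite -ltr_ln ?posrE ?powR_gt0// ln_powR.
  have := normr_ge0 (ln t1); rewrite !mulrN in key alr *; lra.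
have := mixed_difference_mild_cov_diag_ge al1 al2 H1 alH t0 neq hal.
apply: le_trans.
rewrite real_normK ?num_real//; set c := (128 * _ * _)^-1.
have c0 : 0 <= c * (x - y) ^+ 2.
  by rewrite mulr_ge0 ?sqr_ge0// invr_ge0 !mulr_ge0 ?expR_ge0 ?pi_ge0.
rewrite [leLHS](_ : _ = c * (x - y) ^+ 2 * (al / 2 * - ln r)); last by ring.
rewrite ler_wpM2l//; rewrite !mulrN in key alr *; lra.
Qed.

End correlation.

Theorem proposition7p5 (R : realType) (alpha H : R)
    (d : measure_display) (T : measurableType d) (P : probability T R)
    (W : (R * R -> R) -> {RV P >-> R}) (G : R -> R -> R)
    (u : R -> R -> {RV P >-> R}) (t1 t2 : R) :
  0 < alpha -> alpha <= 2 -> 1 / 2 <= H -> H < 1 -> alpha * H = 3 / 2 ->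
  wiener_integral H W ->
  fundamental_solution alpha G ->
  mild_solution W G u ->
  0 < t1 -> t1 < t2 ->
  exists2 C : R, 0 < C &
  forall eps : R, 0 < eps < 1 ->
  exists rho r_rho : R,
    [/\ 0 < rho < 1, rho <= C * eps ^+ 2, 0 < r_rho < 1 &
     forall t r x y x' y' : R,
       t1 <= t <= t2 -> 0 < r <= r_rho ->
       `|x - y| <= r -> `|x' - y'| <= r -> 2 * r `^ rho <= `|x - x'| ->
       (`| 'E_P[((u t x \- u t y) \* (u t x' \- u t y'))%R] |
        <= eps%:E * 'N[P]_2%:E[EFin \o (u t x \- u t y)%R]
                  * 'N[P]_2%:E[EFin \o (u t x' \- u t y')%R])%E].
Proof.
move=> al0 al2 _ H1 alH hW hG hu t10 t12.
have al1 : 1 < alpha.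
  have : alpha * H < alpha by rewrite -[ltRHS]mulr1 ltr_pM2l.
  by rewrite alH; lra.
(* [K] and [c] are the constants of the upper and of the lower bound; [C] makes
   [K * rho <= eps * c], the first term of [L] ensures [1 <= rho * L] and the
   second one that [r] is small with respect to [t1]. *)
pose A := Num.max 1 t2; pose K := mixed_constant alpha H A.
have A0 : 0 < A by rewrite lt_max ltr01.
have K0 : 0 < K by exact: mixed_constant_gt0.
pose c : R := (128 * expR 1 * pi)^-1 * (alpha / 2).
have c0 : 0 < c by rewrite mulr_gt0 ?invr_gt0 ?mulr_gt0 ?expR_gt0 ?pi_gt0 ?divr_gt0.
pose C := Num.min 2^-1 (c / K).
have C0 : 0 < C by rewrite lt_min invr_gt0 ltr0n divr_gt0.
exists C => // eps /andP[eps0 eps1].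
pose rho := C * eps ^+ 2; pose L := rho^-1 + 2 * `|ln t1| / alpha.
have e2 : eps ^+ 2 < 1 by rewrite expr_lt1// ltW.
have rho0 : 0 < rho by rewrite mulr_gt0 ?exprn_gt0.
have rho1 : rho < 1.
  apply: (@lt_trans _ _ C); first by rewrite -[ltRHS]mulr1 ltr_pM2l.
  by rewrite gt_min; apply/orP; left; lra.
have rhoK : K * rho <= eps * c.
  have : K * C <= c by rewrite mulrC -ler_pdivlMr// ge_min lexx orbT.
  rewrite /rho mulrA => KC.
  apply: (@le_trans _ _ (c * eps ^+ 2)); first by rewrite ler_wpM2r ?sqr_ge0.
  by rewrite mulrC ler_pM2r// expr2 -[leRHS]mulr1 ler_pM2l// ltW.
have lt10 : 0 <= 2 * `|ln t1| / alpha by rewrite divr_ge0 ?mulr_ge0 ?(ltW al0).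
have L0 : 0 < L by rewrite ltr_wpDr ?invr_gt0.
exists rho, (expR (- L)); split.
- by rewrite rho0.
- exact: lexx.
- by rewrite expR_gt0 expR_lt1 oppr_lt0.
move=> t r x y x' y' /andP[t1t tt2] /andP[r0 rL] xy xy' xx'.
have t0 : 0 < t by exact: lt_le_trans t1t.
have lnr : L <= - ln r by rewrite lerNr -ler_expR lnK.
have r1 : r < 1 by rewrite (le_lt_trans rL)// expR_lt1 oppr_lt0.
have r01 : 0 < r <= 1 by rewrite r0 ltW.
have mu z : measurable_fun [set: T] (u t z) by [].
have cov z z' := expectation_mild_solution z z' al1 al2 H1 alH hW hG hu t0.
have covD := expectation_increments (X := u t) _ _ _ _ mu cov.
have nrm z z' := Lnorm2_sqrt (covD z z' z z').
rewrite covD !nrm -!EFinM lee_fin.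
have tA : 0 < t <= A by rewrite t0 le_max tt2 orbT.
have A1 : 1 <= A by rewrite le_max lexx.
have rho01 : 0 < rho <= 1 by rewrite rho0 ltW.
have rhoL : 1 <= rho * - ln r.
  rewrite -ler_pdivrMl// mulr1 (le_trans _ lnr)// lerDl//.
apply: le_trans (mixed_difference_mild_cov_small al1 al2 H1 alH tA A1 rho01 r01 rhoL xy xy' xx') _.
have lr0 : 0 <= - ln r by rewrite (le_trans (ltW L0)).
have diag z z' : `|z - z'| <= r ->
    `|z - z'| * Num.sqrt (c * - ln r) <=
    Num.sqrt (mixed_difference (mild_cov alpha H t) z z' z z').
  move=> zz'; have r01' : 0 < r < 1 by rewrite r0.
  have lnr' : 2 * `|ln t1| / alpha < - ln r.
    by rewrite (lt_le_trans _ lnr)// ltrDr invr_gt0.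
  have := mixed_difference_mild_cov_diag_large al1 al2 H1 alH t10 t1t r01' lnr' zz'.
  move=> h; rewrite -{1}(sqrtr_sqr (z - z')) -sqrtrM ?sqr_ge0//.
  by rewrite ler_wsqrtr// -(real_normK (num_real (z - z'))).
have := ler_pM (mulr_ge0 (normr_ge0 _) (sqrtr_ge0 _))
  (mulr_ge0 (normr_ge0 _) (sqrtr_ge0 _)) (diag x y xy) (diag x' y' xy').
rewrite mulrACA -expr2 sqr_sqrtr; last by rewrite mulr_ge0// ltW.
move=> h; rewrite -[leRHS]mulrA; apply: le_trans (ler_wpM2l (ltW eps0) h).
rewrite [leRHS]mulrCA ler_wpM2l ?mulr_ge0//.
by rewrite (mulrA _ rho) (mulrA eps) ler_wpM2r.
Qed.
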